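(* Let $L_1,\ldots,L_p$ be i.i.d. uniformly distributed over the sphere $S^{d-1}\subset\mathbb{R}^d$ and independent of $Z\sim\mathcal{EC}_d(0,I)$, with $u_d$ the normalizing constants of $\|Z\|_2^2$ (see context). Then as $d\to\infty$ and $p\to\infty$, $$\max_{1\le j\le p}|\langle L_j,Z\rangle|\big/\sqrt{u_d(1-p^{-2/(d-1)})}\to 1\quad\text{in probability},$$ i.e. for every $\delta>0$, $$\lim_{p,d\to\infty}\mathbb{P}\Big(\Big|\max_{j}|\langle L_j,Z\rangle|\big/\sqrt{u_d(1-p^{-2/(d-1)})}-1\Big|>\delta\Big)=0.$$ In particular, if $Z\sim\mathcal{N}_d(0,I)$, then as $d\to\infty$ and $p\to\infty$, $$\max_{1\le j\le p}|\langle L_j,Z\rangle|\big/\sqrt{d(1-p^{-2/(d-1)})}\to 1\quad\text{in probability}.$$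
   Context: $Z\sim\mathcal{EC}_d(0,I)$ means that $Z$ is a random vector in $\mathbb{R}^d$ with density $f(z)\propto g(z^Tz)$ for some continuous integrable function $g$; then $Z=\|Z\|_2U$ with $U$ uniform on the unit sphere $S^{d-1}$ and independent of $\|Z\|_2$. Standing assumption: the law of $\|Z\|_2$ depends only on $d$, and there are sequences of positive constants $u_d,v_d$ depending only on $d$ and a proper (almost surely finite) random variable $F_\infty$ such that, as $d\to\infty$, $(\|Z\|_2^2-u_d)/v_d\to F_\infty$ in distribution and $\|Z\|_2^2/u_d\to1$ in probability. The notation $\lim_{p,d\to\infty}$ denotes the double limit as $p$ and $d$ tend to infinity jointly, with no restriction on their relative rates. *)

(* Defs.v *)
From HB Require Import structures.
From mathcomp Require Import all_boot all_order all_algebra.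
From mathcomp Require Import all_classical all_reals all_analysis
  measurable_realfun.

Set Implicit Arguments.
Unset Strict Implicit.
Unset Printing Implicit Defensive.

Import Order.TTheory GRing.Theory Num.Theory.
Import numFieldNormedType.Exports.

Local Open Scope classical_set_scope.
Local Open Scope ring_scope.

(* Vectors of R^d are the tuples [d.-tuple R]: the library equips them with
   the product (i.e. Borel) sigma-algebra, and matrices with none. *)

Section euclidean.
Context {R : realType} {d : nat}.

Definition dotp (x y : d.-tuple R) : R := \sum_(i < d) tnth x i * tnth y i.

Definition sqnorm (x : d.-tuple R) : R := dotp x x.

Definition enorm (x : d.-tuple R) : R := Num.sqrt (sqnorm x).

Definition normalize (x : d.-tuple R) : d.-tuple R :=
  [tuple (enorm x)^-1 * tnth x i | i < d].

Definition centered_sqnorm (u v : R) (x : d.-tuple R) : R :=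
  (sqnorm x - u) / v.

Lemma measurable_sqnorm : measurable_fun [set: d.-tuple R] sqnorm.
Proof.
apply: measurable_sum => i.
by apply: measurable_funM; exact: measurable_tnth.
Qed.

HB.instance Definition _ :=
  isMeasurableFun.Build _ _ _ _ sqnorm measurable_sqnorm.

Lemma measurable_centered_sqnorm (u v : R) :
  measurable_fun [set: d.-tuple R] (centered_sqnorm u v).
Proof.
by apply: measurable_funM => //; apply: measurable_funB.
Qed.

HB.instance Definition _ (u v : R) :=
  isMeasurableFun.Build _ _ _ _ (centered_sqnorm u v)
    (measurable_centered_sqnorm u v).

End euclidean.

Section lebesgue_step.
Context {R : realType} {n : nat}.
Variable mu : {sigma_finite_measure set (n.-tuple R) -> \bar R}.

Definition tcons (x : R * n.-tuple R) : n.+1.-tuple R :=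
  [tuple of x.1 :: x.2].

Lemma measurable_tcons : measurable_fun [set: R * n.-tuple R] tcons.
Proof. exact: measurable_cons. Qed.

Definition lebesgue_step : set (n.+1.-tuple R) -> \bar R :=
  pushforward (@lebesgue_measure R \x mu)%E tcons.

Let nu := measure_function_pushforward__canonical__measure_function_Measure
  (@lebesgue_measure R \x mu)%E measurable_tcons.

Let step0 : lebesgue_step set0 = 0%E.
Proof. exact: (measure0 nu). Qed.

Let step_ge0 A : (0 <= lebesgue_step A)%E.
Proof. exact: (measure_ge0 nu). Qed.

Let step_sigma_additive : semi_sigma_additive lebesgue_step.
Proof. exact: (@measure_semi_sigma_additive _ _ _ nu). Qed.

HB.instance Definition _ := isMeasure.Build _ _ _ lebesgue_step
  step0 step_ge0 step_sigma_additive.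

Let tuncons (x : n.+1.-tuple R) : R * n.-tuple R := (thead x, [tuple of behead x]).

Let tconsK : cancel tcons tuncons.
Proof. by move=> [x t]; congr pair; exact: val_inj. Qed.

Let measurable_tuncons : measurable_fun [set: n.+1.-tuple R] tuncons.
Proof.
apply/measurable_fun_pairP; split; first exact: measurable_tnth.
exact: measurable_behead.
Qed.

Let step_sigma_finite : sigma_finite setT lebesgue_step.
Proof.
have /sigma_finiteP[F [TF ndF Foo]] := sigma_finiteT (@lebesgue_measure R).
have /sigma_finiteP[G [TG ndG Goo]] := sigma_finiteT mu.
exists (fun k => tuncons @^-1` (F k `*` G k)).
  rewrite -preimage_bigcup (_ : \bigcup_k _ = setT) ?preimage_setT//.
  apply/seteqP; split=> // -[x y] _.
  have [i _ Fix] : (\bigcup_i F i) x by rewrite -TF.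
  have [j _ Gjy] : (\bigcup_i G i) y by rewrite -TG.
  exists (maxn i j) => //; split => /=.
    by move: x Fix; exact/subsetPset/ndF/leq_maxl.
  by move: y Gjy; exact/subsetPset/ndG/leq_maxr.
move=> k; have [mF Fk] := Foo k; have [mG Gk] := Goo k; split.
  rewrite -[X in measurable X]setTI.
  by apply: measurable_tuncons => //; exact: measurableX.
rewrite /lebesgue_step /pushforward (_ : _ @^-1` _ = F k `*` G k).
  by rewrite product_measure1E// lte_mul_pinfty// ge0_fin_numE.
by apply/seteqP; split=> x; rewrite /preimage /mkset tconsK.
Qed.

HB.instance Definition _ := Measure_isSigmaFinite.Build _ _ _ lebesgue_step
  step_sigma_finite.

End lebesgue_step.

(* Lebesgue measure on R^n, by iterated products; R^0 is a point of mass 1. *)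
Fixpoint lebesgue_tuple (R : realType) (n : nat) :
    {sigma_finite_measure set (n.-tuple R) -> \bar R} :=
  match n with
  | 0 => \d_([tuple] : 0.-tuple R)
  | m.+1 => lebesgue_step (lebesgue_tuple R m)
  end.

Section random_vectors.
Context {R : realType} {dsp : measure_display} {Om : measurableType dsp}.
Variable P : probability Om R.

Definition mutually_independent (dsp' : measure_display)
    (T : measurableType dsp') (I : finType) (X : I -> {RV P >-> T}) : Prop :=
  forall (J : {set I}) (A : I -> set T), (forall i, measurable (A i)) ->
    (P (\bigcap_(i in [set i | i \in J]) (X i @^-1` A i)) =
     \prod_(i in J) P (X i @^-1` A i))%E.

(* [g_sigma_preimage X] is the sigma-algebra generated by X_0, ..., X_(n-1). *)
Definition independent_of_family (dsp1 dsp2 : measure_display)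
    (T1 : measurableType dsp1) (T2 : measurableType dsp2) (n : nat)
    (X : 'I_n -> {RV P >-> T1}) (Y : {RV P >-> T2}) : Prop :=
  forall (A : set Om) (B : set T2),
    g_sigma_preimage (fun i => X i : Om -> T1) A -> measurable B ->
    (P (A `&` Y @^-1` B) = P A * P (Y @^-1` B))%E.

Definition has_density (d : nat) (X : {RV P >-> d.-tuple R})
    (f : d.-tuple R -> R) : Prop :=
  (forall x, 0 <= f x) /\
  forall A, measurable A ->
    P (X @^-1` A) = (\int[lebesgue_tuple R d]_(x in A) (f x)%:E)%E.

(* The density generator [g] only matters on [0, +oo[, and integrability is
   that of z |-> g(z^T z) on R^d. *)
Definition elliptically_contoured (d : nat) (Z : {RV P >-> d.-tuple R}) : Prop :=
  exists (g : R -> R) (c : R),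
    [/\ {within `[0, +oo[, continuous g},
        (lebesgue_tuple R d).-integrable setT (fun z => (g (sqnorm z))%:E) &
        has_density Z (fun z => c * g (sqnorm z))].

Definition standard_normal (d : nat) (Z : {RV P >-> d.-tuple R}) : Prop :=
  has_density Z (fun z => Num.sqrt (2 * pi) ^- d * expR (- sqnorm z / 2)).

End random_vectors.

(* Surface area on S^(d-1): d times the volume of the cone that a subset of
   the sphere spans in the unit ball.  [A] stands for its trace on the
   sphere. *)
Definition sphere_area (R : realType) (d : nat) (A : set (d.-tuple R)) : \bar R :=
  (d%:R%:E * lebesgue_tuple R d
     [set x | (0 < enorm x <= 1)%R /\ A (normalize x)])%E.

Definition uniform_on_sphere (R : realType) (dsp : measure_display)
    (Om : measurableType dsp) (P : probability Om R) (d : nat)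
    (L : {RV P >-> d.-tuple R}) : Prop :=
  forall A, measurable A ->
    P (L @^-1` A) = (fine (sphere_area A) / fine (@sphere_area R d setT))%:E.

(* The index runs along an arbitrary filter, and each variable lives on its
   own probability space. *)
Definition cvg_in_probability (R : realType) (I : Type) (F : set_system I)
    (dsp : I -> measure_display) (Om : forall i, measurableType (dsp i))
    (P : forall i, probability (Om i) R) (X : forall i, Om i -> R) (c : R) : Prop :=
  forall delta : R, 0 < delta ->
    P i [set w | delta < `|X i w - c|] @[i --> F] --> 0%E.

Definition cvg_in_distribution (R : realType)
    (dsp : nat -> measure_display) (Om : forall n, measurableType (dsp n))
    (P : forall n, probability (Om n) R) (X : forall n, {RV (P n) >-> R})
    (dsp' : measure_display) (Om' : measurableType dsp')
    (P' : probability Om' R) (Y : {RV P' >-> R}) : Prop :=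
  forall x : R, {for x, continuous (cdf Y)} ->
    cdf (X n) x @[n --> \oo] --> cdf Y x.

Definition max_abs_dotp (R : realType) (d p : nat) (l : 'I_p -> d.-tuple R)
    (z : d.-tuple R) : R :=
  \big[Num.max/0]_(j < p) `|dotp (l j) z|.

(* At d = 1 the exponent is 2 / 0 = 0; this does not affect limits in d. *)
Definition max_scale (R : realType) (u : R) (p d : nat) : R :=
  Num.sqrt (u * (1 - p%:R `^ (- (2 / (d%:R - 1))))).

(* Main.v *)
(* Conditionally on Z = z the inner products <L_j, z> / |z| are independent,
   and by rotation invariance P(|<L_j, z>| > r |z|) = q(r) does not depend on
   z.  With n = d - 1 and s^2 = 1 - p^(-2/n), volume comparisons between the
   cone over a cap, balls and cylinders give
     q(r) <= 4 (1 - r^2)^(n/2)    and, for r < r' < 1,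
     q(r) >= (r' - r) (1 - r'^2)^(n/2) / sqrt(2 pi / n).
   The choice of s makes (1 - s^2)^(n/2) = 1/p, and convexity of exp turns this
   into p q((1 + e) s) <= 4 p^(-2e) and p q((1 - e) s) >= (e / 16) p^(e/2), with
   no loss depending on n since n s^2 >= 1/4.  As (1 - q)^p <= 1 / (p q), the
   maximum lies within a factor 1 +- e of s |Z| with a probability tending to 1
   uniformly in d, and what remains is that |Z|^2 / u_d -> 1 in probability,
   uniformly in p because the law of |Z| does not involve p.  For the normal
   law, that convergence with u_d = d follows by comparing its density with
   those of the centred normal laws of variance 1 + e and 1 - e. *)

Require Import Defs.
From HB Require Import structures.
From mathcomp Require Import all_boot all_order all_algebra.
From mathcomp Require Import all_classical all_reals all_analysis.
From mathcomp Require Import measurable_realfun ring lra.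

Set Implicit Arguments.
Unset Strict Implicit.
Unset Printing Implicit Defensive.

Import Order.TTheory GRing.Theory Num.Theory.
Import numFieldNormedType.Exports.

Local Open Scope classical_set_scope.
Local Open Scope ring_scope.

(** * Lebesgue measure on the line and on tuples *)

Section lebesgue_line.
Context {R : realType}.
Notation lambda := (@lebesgue_measure R).

(** The pushforward of [lambda] by the translation has the right values on half-open intervals, and
    these determine Lebesgue measure. *)
Lemma lebesgue_measure_shift (c : R) (A : set R) : measurable A ->
  lambda [set x | A (c + x)] = lambda A.
Proof.
move=> mA; have mf : measurable_fun [set: measurableTypeR R] (+%R c : _ ->
  measurableTypeR R).
  exact: measurable_funD.
pose nu := measure_function_pushforward__canonical__measure_function_Measure
  lambda mf.
apply/esym/(@lebesgue_measure_unique R nu) => //= _ [[a b]] _ <-.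
rewrite /pushforward (_ : _ @^-1` _ = `]a - c, b - c]%classic).
  rewrite !lebesgue_measure_itv/= !lte_fin ltrD2r; case: ifP => // _.
  by congr (_%:E); lra.
by apply/seteqP; split => x /=; rewrite !in_itv/= => /andP[? ?]; apply/andP;
  split; lra.
Qed.

(** The same uniqueness argument, for [a] times the pushforward of [lambda] under multiplication by
    [a]. *)
Lemma lebesgue_measure_scale (a : R) (A : set R) : 0 < a -> measurable A ->
  (a%:E * lambda [set x | A (a * x)%R])%E = lambda A.
Proof.
move=> a0 mA; have mf : measurable_fun [set: measurableTypeR R] ( *%R a : _ ->
  measurableTypeR R).
  exact: measurable_funM.
pose nu := measure_function_pushforward__canonical__measure_function_Measure
  lambda mf.
pose nu' := mscale (NngNum (ltW a0)) nu.
apply/esym/(@lebesgue_measure_unique R nu') => //= _ [[c b]] _ <-.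
rewrite /nu' /mscale/= /pushforward (_ : _ @^-1` _ = `](c / a), (b /
  a)]%classic).
  rewrite !lebesgue_measure_itv/= !lte_fin ltr_pM2r ?invr_gt0//.
  case: ifP => // _; last by rewrite mule0.
  by rewrite -!EFinB -EFinM; congr (_%:E); field; lra.
by apply/seteqP; split => x /=;
  rewrite !in_itv/= ltr_pdivrMr// ler_pdivlMr// mulrC.
Qed.

End lebesgue_line.

(** * Vector operations on tuples and their measurability *)

Section tuples.
Context {R : realType}.

Definition axpy (n : nat) (a : R) (x y : n.-tuple R) : n.-tuple R :=
  [tuple a * tnth x i + tnth y i | i < n].

Definition tscale (n : nat) (a : R) (x : n.-tuple R) : n.-tuple R :=
  [tuple a * tnth x i | i < n].

Definition ttail (n : nat) (t : n.+1.-tuple R) : n.-tuple R :=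
  [tuple of behead t].

Lemma ttail_tcons (n : nat) (x : R) (t : n.-tuple R) : ttail (tcons (x, t)) = t.
Proof. exact: val_inj. Qed.

Lemma tcons_eta (n : nat) (t : n.+1.-tuple R) : t = tcons (thead t, ttail t).
Proof. by rewrite /tcons/= [LHS]tuple_eta. Qed.

Lemma measurable_ttail (n : nat) : measurable_fun [set: n.+1.-tuple R] (@ttail
  n).
Proof. exact: measurable_behead. Qed.

Lemma axpy_tcons (n : nat) (a x y : R) (t s : n.-tuple R) :
  axpy a (tcons (x, t)) (tcons (y, s)) = tcons (a * x + y, axpy a t s).
Proof.
apply: eq_from_tnth => i; rewrite tnth_mktuple.
case: (unliftP ord0 i) => [j ->|->]; first by rewrite !tnthS tnth_mktuple.
by rewrite !tnth0.
Qed.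

Lemma tscale_tcons (n : nat) (a x : R) (t : n.-tuple R) :
  tscale a (tcons (x, t)) = tcons (a * x, tscale a t).
Proof.
apply: eq_from_tnth => i; rewrite tnth_mktuple.
case: (unliftP ord0 i) => [j ->|->]; first by rewrite !tnthS tnth_mktuple.
by rewrite !tnth0.
Qed.

Lemma axpy_tconsl (n : nat) (a x : R) (t : n.-tuple R) (s : n.+1.-tuple R) :
  axpy a (tcons (x, t)) s = tcons (a * x + thead s, axpy a t (ttail s)).
Proof. by rewrite [in LHS](tcons_eta s) axpy_tcons. Qed.

Lemma tscale_eta (n : nat) (a : R) (s : n.+1.-tuple R) :
  tscale a s = tcons (a * thead s, tscale a (ttail s)).
Proof. by rewrite [in LHS](tcons_eta s) tscale_tcons. Qed.

Lemma dotpC (n : nat) (x y : n.-tuple R) : dotp x y = dotp y x.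
Proof. by apply: eq_bigr => i _; rewrite mulrC. Qed.

Lemma dotp_axpy (n : nat) (a : R) (x y z : n.-tuple R) :
  dotp z (axpy a x y) = a * dotp z x + dotp z y.
Proof.
rewrite mulr_sumr -big_split/=; apply: eq_bigr => i _.
by rewrite tnth_mktuple; ring.
Qed.

Lemma dotp_tscale (n : nat) (a : R) (x z : n.-tuple R) :
  dotp z (tscale a x) = a * dotp z x.
Proof.
by rewrite mulr_sumr; apply: eq_bigr => i _; rewrite tnth_mktuple; ring.
Qed.

Lemma dotp_tcons (n : nat) (x y : R) (t s : n.-tuple R) :
  dotp (tcons (x, t)) (tcons (y, s)) = x * y + dotp t s.
Proof.
rewrite /dotp big_ord_recl/= !tnth0; congr (_ + _).
by apply: eq_bigr => i _; rewrite !tnthS.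
Qed.

Lemma sqnorm_tcons (n : nat) (x : R) (t : n.-tuple R) :
  sqnorm (tcons (x, t)) = x ^+ 2 + sqnorm t.
Proof. exact: dotp_tcons. Qed.

Lemma sqnorm_eta (n : nat) (t : n.+1.-tuple R) :
  sqnorm t = thead t ^+ 2 + sqnorm (ttail t).
Proof. by rewrite [in LHS](tcons_eta t) sqnorm_tcons. Qed.

Lemma sqnorm_axpy (n : nat) (a : R) (x y : n.-tuple R) :
  sqnorm (axpy a x y) = a ^+ 2 * sqnorm x + a * dotp x y *+ 2 + sqnorm y.
Proof.
rewrite /sqnorm dotp_axpy (dotpC _ x) (dotpC _ y) !dotp_axpy (dotpC y x); ring.
Qed.

Lemma sqnorm_tscale (n : nat) (a : R) (x : n.-tuple R) :
  sqnorm (tscale a x) = a ^+ 2 * sqnorm x.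
Proof. by rewrite /sqnorm dotp_tscale dotpC dotp_tscale; ring. Qed.

Lemma sqnorm_ge0 (n : nat) (x : n.-tuple R) : 0 <= sqnorm x.
Proof. by apply: sumr_ge0 => i _; rewrite -expr2 sqr_ge0. Qed.

Lemma sqr_enorm (n : nat) (x : n.-tuple R) : enorm x ^+ 2 = sqnorm x.
Proof. by rewrite sqr_sqrtr// sqnorm_ge0. Qed.

Lemma enorm_ge0 (n : nat) (x : n.-tuple R) : 0 <= enorm x.
Proof. exact: sqrtr_ge0. Qed.

(** The coefficient varies with [t] while [w] stays fixed, as in the shears used below. *)
Lemma measurable_axpy (n : nat) (w : n.-tuple R) (c : R) d (T : measurableType
  d)
    (f : T -> R) (g : T -> n.-tuple R) :
  measurable_fun setT f -> measurable_fun setT g ->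
  measurable_fun setT (fun t => axpy (c * f t) w (g t)).
Proof.
move=> mf mg; apply/measurable_fun_tnthP => i /=.
rewrite [X in measurable_fun _ X](_ : _ = fun t =>
  c * f t * tnth w i + tnth (g t) i).
  apply: measurable_funD; first by apply: measurable_funM => //;
    apply: measurable_funM.
  by apply: (@measurableT_comp _ _ _ _ _ _ (fun x => tnth x i)) => //;
    exact: measurable_tnth.
by apply/funext => t /=; rewrite tnth_mktuple.
Qed.

Lemma measurable_tscale (n : nat) (c : R) d (T : measurableType d)
    (g : T -> n.-tuple R) :
  measurable_fun setT g -> measurable_fun setT (fun t => tscale c (g t)).
Proof.
move=> mg; apply/measurable_fun_tnthP => i /=.
rewrite [X in measurable_fun _ X](_ : _ = fun t => c * tnth (g t) i).
  apply: measurable_funM => //.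
  by apply: (@measurableT_comp _ _ _ _ _ _ (fun x => tnth x i)) => //;
    exact: measurable_tnth.
by apply/funext => t /=; rewrite tnth_mktuple.
Qed.

Lemma measurable_dotp (n : nat) d (T : measurableType d)
    (f g : T -> n.-tuple R) :
  measurable_fun setT f -> measurable_fun setT g ->
  measurable_fun setT (fun t => dotp (f t) (g t)).
Proof.
move=> mf mg; apply: measurable_sum => i; apply: measurable_funM.
  by apply: (@measurableT_comp _ _ _ _ _ _ (fun x => tnth x i)) => //;
    exact: measurable_tnth.
by apply: (@measurableT_comp _ _ _ _ _ _ (fun x => tnth x i)) => //;
  exact: measurable_tnth.
Qed.

Lemma measurable_enorm (n : nat) d (T : measurableType d)
    (f : T -> n.-tuple R) :
  measurable_fun setT f -> measurable_fun setT (fun t => enorm (f t)).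
Proof.
move=> mf; apply: (@measurableT_comp _ _ _ _ _ _ (@Num.sqrt R)).
  by apply: continuous_measurable_fun; exact: sqrt_continuous.
exact: measurable_dotp.
Qed.

Lemma measurable_norm d (T : measurableType d) (f : T -> R) :
  measurable_fun setT f -> measurable_fun setT (fun t => `|f t|).
Proof. by move=> mf; apply: measurableT_comp => //;
  exact: normr_measurable. Qed.

Lemma measurable_thead (n : nat) :
  measurable_fun [set: n.+1.-tuple R] (fun t => thead t).
Proof. exact: measurable_tnth. Qed.

Lemma measurable_preim d d' (T : measurableType d) (U : measurableType d')
    (f : T -> U) (A : set U) :
  measurable_fun setT f -> measurable A -> measurable [set x | A (f x)].
Proof. by move=> mf mA; rewrite -[X in measurable X]setTI; exact: mf. Qed.

End tuples.

(** * Volume under slicing, shears, translations and dilations *)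

Section lebesgue_tuple.
Context {R : realType}.
Notation lambda := (@lebesgue_measure R).
Notation vol n := (lebesgue_tuple R n).

Lemma vol_slice1 (n : nat) (A : set (n.+1.-tuple R)) :
  vol n.+1 A = (\int[lambda]_x vol n [set y | A (tcons (x, y))])%E.
Proof.
rewrite /= /lebesgue_step /pushforward /product_measure1.
apply: eq_integral => x _ /=; congr (vol n _).
by apply/seteqP; split => y; rewrite xsectionE.
Qed.

(** The product measure is defined by sections over the head; uniqueness on rectangles allows the
    other order of integration. *)
Lemma vol_slice2 (n : nat) (A : set (n.+1.-tuple R)) : measurable A ->
  vol n.+1 A = (\int[vol n]_y lambda [set x | A (tcons (x, y))])%E.
Proof.
move=> mA; rewrite /= /lebesgue_step /pushforward.
rewrite (@product_measure_unique _ _ _ _ _ lambda (vol n) (lambda \x^ vol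
  n)%E); last 2 first.
- by move=> B C mB mC; exact: product_measure2E.
- by apply: measurable_preim => //; exact: measurable_tcons.
apply: eq_integral => x _ /=; congr (lambda _).
by apply/seteqP; split => y; rewrite ysectionE.
Qed.

Lemma measurable_tconsl (n : nat) (x : R) :
  measurable_fun [set: n.-tuple R] (fun y => tcons (x, y)).
Proof. by apply: measurable_cons;
  [exact: measurable_cst|exact: measurable_id]. Qed.

Lemma measurable_tconsr (n : nat) (y : n.-tuple R) :
  measurable_fun [set: R] (fun x => tcons (x, y)).
Proof. by apply: measurable_cons;
  [exact: measurable_id|exact: measurable_cst]. Qed.

Lemma measurable_fun_tcons (n : nat) d (T : measurableType d)
    (f : T -> R) (g : T -> n.-tuple R) :
  measurable_fun setT f -> measurable_fun setT g ->
  measurable_fun setT (fun t => tcons (f t, g t)).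
Proof. exact: measurable_cons. Qed.

Lemma measurable_vol_slice1 (n : nat) (A : set (n.+1.-tuple R)) : measurable A
  ->
  measurable_fun [set: R] (fun x => vol n [set y | A (tcons (x, y))]).
Proof.
move=> mA; have mB : measurable (@tcons R n @^-1` A).
  by apply: measurable_preim => //; exact: measurable_tcons.
rewrite [X in measurable_fun _ X](_ : _ = vol n \o xsection (@tcons R n @^-1`
  A)).
  exact: measurable_fun_xsection.
by apply/funext => x /=; rewrite xsectionE.
Qed.

Lemma measurable_vol_slice2 (n : nat) (A : set (n.+1.-tuple R)) : measurable A
  ->
  measurable_fun [set: n.-tuple R] (fun y => lambda [set x | A (tcons (x, y))]).
Proof.
move=> mA; have mB : measurable (@tcons R n @^-1` A).
  by apply: measurable_preim => //; exact: measurable_tcons.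
rewrite [X in measurable_fun _ X](_ : _ = lambda \o ysection (@tcons R n @^-1`
  A)).
  exact: measurable_fun_ysection.
by apply/funext => x /=; rewrite ysectionE.
Qed.

(** For each fixed tail the shear is a translation of the line. *)
Lemma vol_shear_head (n : nat) (phi : n.-tuple R -> R) (A : set (n.+1.-tuple
  R)) :
  measurable_fun setT phi -> measurable A ->
  vol n.+1 [set t | A (tcons (phi (ttail t) + thead t, (ttail t)))] =
  vol n.+1 A.
Proof.
move=> mphi mA; rewrite !vol_slice2//; last first.
  apply: measurable_preim => //; apply: measurable_fun_tcons;
    last exact: measurable_ttail.
  apply: measurable_funD; last exact: measurable_thead.
  by apply: measurableT_comp => //; exact: measurable_ttail.
apply: eq_integral => y _.
rewrite -(@lebesgue_measure_shift R (phi y) [set x | A (tcons (x, y))]);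
  last first.
  by apply: measurable_preim => //; exact: measurable_tconsr.
by congr (lambda _); apply/seteqP; split => x /=; rewrite ?ttail_tcons ?theadE.
Qed.

(** Induction on the dimension: a translation of the head, which is a shear with constant [phi],
    followed by a translation of each slice. *)
Lemma vol_shift (n : nat) (w : n.-tuple R) (a : R) (A : set (n.-tuple R)) :
  measurable A ->
  vol n [set y | A (axpy a w y)] = vol n A.
Proof.
elim: n w A => [|n IH] w A mA.
  congr (vol 0 _); apply/seteqP; split => y /=;
    rewrite (tuple0 y) (_ : axpy _ _ _ = [tuple])//; exact: tuple0.
rewrite (tcons_eta w); move: (thead w) (X in tcons (_, X)) => {}w0 {}w.
pose A1 := [set t : n.+1.-tuple R | A (tcons (thead t, axpy a w (ttail t)))].
have -> : [set y | A (axpy a (tcons (w0, w)) y)] =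
  [set t | A1 (tcons (a * w0 + thead t, ttail t))].
  by apply/seteqP; split => t /=;
    rewrite /A1/= axpy_tconsl ?ttail_tcons ?theadE.
transitivity (vol n.+1 A1);
  first apply: (@vol_shear_head n (fun=> a * w0) A1) => //.
  apply: measurable_preim => //; apply: measurable_fun_tcons;
    first exact: measurable_thead.
  rewrite [X in measurable_fun _ X](_ : _ = (fun t : n.+1.-tuple R =>
    axpy (a * 1) w (ttail t))); last by rewrite mulr1.
  by apply: measurable_axpy => //; exact: measurable_ttail.
rewrite !vol_slice1; apply: eq_integral => x _.
rewrite -(IH w [set y | A (tcons (x, y))]); last first.
  by apply: measurable_preim => //; exact: measurable_tconsl.
by congr (vol n _); apply/seteqP; split => y;
  rewrite /A1/= ?ttail_tcons ?theadE.
Qed.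

(** For each fixed head the shear is a translation of the tail. *)
Lemma vol_shear_tail (n : nat) (w : n.-tuple R) (c : R) (A : set (n.+1.-tuple
  R)) :
  measurable A ->
  vol n.+1 [set t | A (tcons (thead t, axpy (c * thead t) w (ttail t)))] =
  vol n.+1 A.
Proof.
move=> mA; rewrite !vol_slice1; apply: eq_integral => x _.
have mAx : measurable [set y | A (tcons (x, y))].
  by apply: measurable_preim => //; exact: measurable_tconsl.
rewrite -(vol_shift w (c * x) mAx).
by congr (vol n _); apply/seteqP; split => y; rewrite /= ttail_tcons theadE.
Qed.

(** The dilation rule for tails is a hypothesis, so that this serves both as the induction step of
    [vol_tscale] and for the anisotropic dilations of [vol_scale2]. *)
Lemma vol_scale_tail (n : nat) (a b : R) (A : set (n.+1.-tuple R)) :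
  0 < a -> 0 < b -> (forall B : set (n.-tuple R), measurable B ->
    ((b ^+ n)%:E * vol n [set y | B (tscale b y)])%E = vol n B) ->
  measurable A ->
  ((a * b ^+ n)%:E *
     vol n.+1 [set t | A (tcons ((a * thead t)%R, tscale b (ttail t)))])%E =
  vol n.+1 A.
Proof.
move=> a0 b0 IH mA; pose A' := [set t | A (tcons (a * thead t, ttail t))].
have mA' : measurable A'.
  apply: measurable_preim => //; apply: measurable_fun_tcons;
    last exact: measurable_ttail.
  by apply: measurable_funM => //; exact: measurable_thead.
transitivity (a%:E * vol n.+1 A')%E.
  rewrite EFinM -muleA; congr (_ * _)%E;
    rewrite !vol_slice1 -ge0_integralZl//; last 2 first.
  - apply: measurable_vol_slice1; apply: measurable_preim => //.
    apply: measurable_fun_tcons; last by apply: measurable_tscale;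
      exact: measurable_ttail.
    by apply: measurable_funM => //; exact: measurable_thead.
  - by rewrite lee_fin exprn_ge0// ltW.
  apply: eq_integral => x _; rewrite -(IH [set y | A' (tcons (x, y))]);
    last first.
    by apply: measurable_preim => //; exact: measurable_tconsl.
  by congr (_ * vol n _)%E; apply/seteqP; split => y /=;
    rewrite /A'/= !ttail_tcons !theadE.
rewrite !vol_slice2// -ge0_integralZl//; last 2 first.
- exact: (measurable_vol_slice2 mA').
- by rewrite lee_fin ltW.
apply: eq_integral => y _;
  rewrite -(@lebesgue_measure_scale R a [set x | A (tcons (x, y))])//;
  last first.
  by apply: measurable_preim => //; exact: measurable_tconsr.
by congr (_ * lambda _)%E; apply/seteqP; split => x /=;
  rewrite /A'/= !ttail_tcons !theadE.
Qed.

Lemma vol_tscale (n : nat) (b : R) (A : set (n.-tuple R)) : 0 < b -> measurable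
  A ->
  ((b ^+ n)%:E * vol n [set y | A (tscale b y)])%E = vol n A.
Proof.
move=> b0; elim: n A => [|n IH] A mA.
  rewrite expr0 mul1e; congr (vol 0 _); apply/seteqP.
  by split => y /=; rewrite (tuple0 y) (_ : tscale _ _ = [tuple])//;
    exact: tuple0.
rewrite -[RHS](vol_scale_tail b0 b0 IH)// exprS; congr (_ * vol n.+1 _)%E.
by apply/seteqP; split => t /=; rewrite tscale_eta.
Qed.

Lemma vol_scale2 (n : nat) (a b : R) (A : set (n.+1.-tuple R)) :
  0 < a -> 0 < b -> measurable A ->
  ((a * b ^+ n)%:E *
     vol n.+1 [set t | A (tcons ((a * thead t)%R, tscale b (ttail t)))])%E =
  vol n.+1 A.
Proof.
by move=> a0 b0 mA; apply: vol_scale_tail => // B mB; exact: vol_tscale.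
Qed.

End lebesgue_tuple.

(** * Volumes of balls *)

Lemma centered_normal_pdfE (R : realType) (s x : R) : s != 0 ->
  normal_pdf 0 s x =
  (Num.sqrt (2 * pi * s ^+ 2))^-1 * expR (- x ^+ 2 / (2 * s ^+ 2)).
Proof.
move=> s0; rewrite normal_pdfE// /normal_peak /normal_fun subr0.
by congr ((Num.sqrt _)^-1 * expR (_ / _)); ring.
Qed.

Section ball_volume.
Context {R : realType}.
Notation lambda := (@lebesgue_measure R).
Notation vol n := (lebesgue_tuple R n).

(** Indexed by the squared radius, so that sections of balls need no square roots. *)
Definition sqball (n : nat) (rho : R) : set (n.-tuple R) :=
  [set x | sqnorm x <= rho].
Arguments sqball : clear implicits.

Lemma measurable_sqball (n : nat) (rho : R) : measurable (sqball n rho).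
Proof.
rewrite (_ : sqball n rho = @sqnorm R n @^-1` `]-oo, rho]%classic).
  by apply: measurable_preim => //; exact: measurable_sqnorm.
by apply/seteqP; split => x /=; rewrite in_itv.
Qed.

Lemma vol_sqball (n : nat) (r : R) : 0 < r ->
  vol n (sqball n (r ^+ 2)) = ((r ^+ n)%:E * vol n (sqball n 1))%E.
Proof.
move=> r0; rewrite -(vol_tscale r0 (@measurable_sqball n _));
  congr (_ * vol n _)%E.
have E x : (r ^+ 2 * sqnorm x <= r ^+ 2) = (sqnorm (x : n.-tuple R) <= 1).
  by rewrite -[X in _ <= X]mulr1 ler_pM2l// exprn_gt0.
by apply/seteqP; split => x; rewrite /sqball/= sqnorm_tscale E.
Qed.

Lemma vol_box (n : nat) (B : set R) (C : set (n.-tuple R)) :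
  measurable B -> measurable C ->
  vol n.+1 [set t | B (thead t) /\ C (ttail t)] = (lambda B * vol n C)%E.
Proof.
move=> mB mC; rewrite -product_measure1E//= /lebesgue_step /pushforward.
congr ((_ \x _)%E _); apply/seteqP.
by split => -[x y] /=; rewrite ttail_tcons theadE.
Qed.

Lemma lebesgue_oc (a b : R) : a < b -> lambda `]a, b]%classic = (b - a)%:E.
Proof. by move=> ab; rewrite lebesgue_measure_itv/= lte_fin ab. Qed.

(** Induction on the dimension: the unit ball lies in the product of an interval and a
    lower-dimensional unit ball. *)
Lemma vol_ball_lty (n : nat) : (vol n (sqball n 1) < +oo)%E.
Proof.
elim: n => [|n IH].
  by rewrite /= diracE; case: (_ \in _); rewrite ltry.
pose C := [set t : n.+1.-tuple R |
  `](-2 : R), 2]%classic (thead t) /\ sqball n 1 (ttail t)].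
apply: (@le_lt_trans _ _ (vol n.+1 C)).
  apply: le_measure; rewrite ?inE.
  - exact: measurable_sqball.
  - apply: measurableI; apply: measurable_preim => //.
    + exact: measurable_thead.
    + exact: measurable_ttail.
    + exact: measurable_sqball.
  - clear IH => t; rewrite /C /sqball/= sqnorm_eta in_itv/=.
    move: (thead t) (ttail t) => x y h; have := sqnorm_ge0 y;
      have := sqr_ge0 x => h1 h2.
    split; last by lra.
    by apply/andP; split; nra.
rewrite vol_box//; last exact: measurable_sqball.
by rewrite lebesgue_oc; [exact: lte_mul_pinfty|clear IH; lra].
Qed.

(** Induction again: the product of an interval of length 1/2 and a ball of radius 1/2 fits in the
    unit ball. *)
Lemma vol_ball_gt0 (n : nat) : (0 < vol n (sqball n 1))%E.
Proof.
elim: n => [|n IH].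
  rewrite /= diracE mem_set ?lte_fin//.
  by rewrite /sqball/= /sqnorm /dotp big_ord0.
pose C := [set t : n.+1.-tuple R |
  `](0 : R), 2^-1]%classic (thead t) /\ sqball n (2^-1 ^+ 2) (ttail t)].
have mC : measurable C.
  apply: measurableI; apply: measurable_preim => //.
  + exact: measurable_thead.
  + exact: measurable_ttail.
  + exact: measurable_sqball.
apply: (@lt_le_trans _ _ (vol n.+1 C)).
  rewrite vol_box//; last exact: measurable_sqball.
  rewrite lebesgue_oc ?invr_gt0// subr0 vol_sqball ?invr_gt0//.
  rewrite mule_gt0// ?lte_fin ?invr_gt0//.
  by rewrite mule_gt0// lte_fin exprn_gt0 ?invr_gt0.
apply: le_measure; rewrite ?inE//; first exact: measurable_sqball.
clear IH => t; rewrite /C /sqball/= sqnorm_eta in_itv/= => -[/andP[h1 h2] h3].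
nra.
Qed.

Lemma vol_ball_fin (n : nat) : vol n (sqball n 1) = (fine (vol n (sqball n
  1)))%:E.
Proof. by rewrite fineK// ge0_fin_numE// vol_ball_lty. Qed.

(* The section of the ball at height x has radius (1 - x^2)^(1/2), at most
   exp (- x^2 / 2), so a Gaussian integral bounds the ratio of volumes. *)
Lemma vol_ball_ratio (n : nat) : (0 < n)%N ->
  (vol n.+1 (sqball n.+1 1) <=
   (Num.sqrt (2 * pi / n%:R))%:E * vol n (sqball n 1))%E.
Proof.
move=> n0; rewrite vol_slice1.
(* With variance 1/n, the n-th power of the radius bound exp (- x^2 / 2) is proportional to the
   normal density. *)
pose s : R := (Num.sqrt n%:R)^-1.
have nR : 0 < n%:R :> R by rewrite ltr0n.
have s0 : s != 0 by rewrite invr_neq0// sqrtr_eq0 -ltNge.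
have s2 : s ^+ 2 = n%:R^-1 by rewrite exprVn sqr_sqrtr// ltW.
apply: (@le_trans _ _ (\int[lambda]_x ((fine (vol n (sqball n 1)) * Num.sqrt (2
  * pi / n%:R))%:E
  * (normal_pdf 0 s x)%:E))%E).
  apply: ge0_le_integral => //.
  - by apply: measurable_vol_slice1; exact: measurable_sqball.
  - by apply/measurable_EFinP; apply: measurable_funM => //;
    exact: measurable_normal_pdf.
  move=> x _; apply: (@le_trans _ _ (vol n (sqball n (expR (- x ^+ 2 / 2) ^+
    2)))).
    apply: le_measure; rewrite ?inE; [|exact: measurable_sqball|].
      by apply: measurable_preim;
        [exact: measurable_tconsl|exact: measurable_sqball].
    move=> y; rewrite /sqball/= sqnorm_tcons -expRM_natl.
    have := expR_ge1Dx (2 * (- x ^+ 2 / 2)); lra.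
  rewrite vol_sqball ?expR_gt0// [in leLHS]vol_ball_fin -!EFinM lee_fin.
  rewrite centered_normal_pdfE// s2 -expRM_natl.
  have h : 0 < Num.sqrt (2 * pi / n%:R) :> R.
    by rewrite sqrtr_gt0 divr_gt0// mulr_gt0// pi_gt0.
  rewrite [leRHS]mulrA mulfK ?gt_eqF// mulrC (_ : n%:R * _ = - x ^+ 2 / (2 /
    n%:R))//.
  by field; rewrite gt_eqF.
rewrite ge0_integralZl//; last 3 first.
- by apply/measurable_EFinP; exact: measurable_normal_pdf.
- by move=> x _; rewrite lee_fin normal_pdf_ge0.
- by rewrite lee_fin mulr_ge0// ?fine_ge0// ?sqrtr_ge0.
by rewrite integral_normal_pdf// mule1 [in leRHS]vol_ball_fin -EFinM mulrC.
Qed.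

End ball_volume.

(** * Volumes of cones over caps *)

Section caps.
Context {R : realType}.
Notation lambda := (@lebesgue_measure R).
Notation vol n := (lebesgue_tuple R n).

(* For a unit vector (c, w), three shears compose to an isometry whose first
   coordinate is the inner product with (c, w). *)
Lemma vol_rotate (n : nat) (c : R) (w : n.-tuple R) (B : set (R * R)) :
  0 <= c -> c ^+ 2 + sqnorm w = 1 -> measurable B ->
  vol n.+1 [set t | B (sqnorm t, dotp (tcons (c, w)) t)] =
  vol n.+1 [set t | B (sqnorm t, thead t)].
Proof.
(* A plane rotation factors into three shears, the outer two with coefficient tan (angle / 2). Here
   c is the cosine and |w| the sine, so that this tangent is a |w|. *)
move=> c0 cw mB; pose a := (1 + c)^-1.
have c1 : 1 + c != 0 by rewrite gt_eqF// ltr_pwDl.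
have mdw : measurable_fun setT (fun y : n.-tuple R => a * dotp w y).
  apply: measurable_funM => //; apply: measurable_dotp;
    first exact: measurable_cst.
  exact: measurable_id.
pose A := [set t : n.+1.-tuple R | B (sqnorm t, thead t)].
have mA : measurable A.
  apply: measurable_preim => //; apply/measurable_fun_pairP; split.
    exact: measurable_sqnorm.
  exact: measurable_thead.
pose A1 := [set t | A (tcons (a * dotp w (ttail t) + thead t, ttail t))].
have mA1 : measurable A1.
  apply: measurable_preim => //; apply: measurable_fun_tcons;
    last exact: measurable_ttail.
  apply: measurable_funD; last exact: measurable_thead.
  by apply: (measurableT_comp mdw); exact: measurable_ttail.
pose A2 := [set t | A1 (tcons (thead t, axpy (-1 * thead t) w (ttail t)))].
have mA2 : measurable A2.
  apply: measurable_preim => //; apply: measurable_fun_tcons;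
    first exact: measurable_thead.
  by apply: measurable_axpy; [exact: measurable_thead|exact: measurable_ttail].
rewrite -/A -(vol_shear_head mdw mA) -/A1 -(vol_shear_tail w (-1) mA1) -/A2.
rewrite -(vol_shear_head mdw mA2); congr (vol n.+1 _).
have E t : A2 (tcons (a * dotp w (ttail t) + thead t, ttail t)) =
    B (sqnorm t, dotp (tcons (c, w)) t).
  rewrite /A2/= /A1/= /A/= !(ttail_tcons, theadE) [in RHS](tcons_eta t).
  move: (thead t) (ttail t) => x y.
  rewrite dotp_tcons !sqnorm_tcons sqnorm_axpy !dotp_axpy -/(sqnorm w).
  have -> : sqnorm w = 1 - c ^+ 2 by lra.
  by congr (B (_, _)); rewrite /a/=; field.
by apply/seteqP; split => t /=; rewrite -E.
Qed.

(** The absolute value allows [theta] to be replaced by its opposite, which provides the nonnegative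
    first coordinate that [vol_rotate] asks for. *)
Lemma vol_rotate_norm (n : nat) (theta : n.+1.-tuple R) (B : set (R * R)) :
  sqnorm theta = 1 -> measurable B ->
  vol n.+1 [set t | B (sqnorm t, `|dotp theta t|)] =
  vol n.+1 [set t | B (sqnorm t, `|thead t|)].
Proof.
move=> th1 mB; pose B' := [set p : R * R | B (p.1, `|p.2|)].
have mB' : measurable B'.
  apply: measurable_preim => //; apply/measurable_fun_pairP; split => //.
    exact: measurable_fst.
  by apply: measurable_norm; exact: measurable_snd.
have [c0|c0] := leP 0 (thead theta).
  rewrite (tcons_eta theta); apply: (@vol_rotate _ _ _ B') => //.
  by rewrite -sqnorm_eta.
rewrite -(@vol_rotate _ (- thead theta) (tscale (-1) (ttail theta)) B')//;
  last 2 first.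
- by rewrite oppr_ge0 ltW.
- by rewrite sqnorm_tscale -[RHS]th1 [in RHS]sqnorm_eta; ring.
congr (vol n.+1 _); apply/funext => t; rewrite /B'/=; congr (B (_, _)).
rewrite [in RHS](tcons_eta t) dotp_tcons [in RHS]dotpC dotp_tscale.
by rewrite {1}(tcons_eta theta) {1}(tcons_eta t) dotp_tcons (dotpC (ttail t))
  mulNr mulN1r -opprD normrN.
Qed.

(** The set whose volume enters [sphere_area] for the double cap where the first coordinate exceeds
    [r] in absolute value. *)
Definition cone (n : nat) (r : R) : set (n.+1.-tuple R) :=
  [set t | 0 < enorm t <= 1 /\ r * enorm t < `|thead t|].
Arguments cone : clear implicits.

Lemma measurable_cone (n : nat) (r : R) : measurable (cone n r).
Proof.
pose B := [set p : R * R | 0 < p.1 <= 1 /\ r * p.1 < `|p.2|].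
apply: (@measurable_preim _ _ _ _ (fun t : n.+1.-tuple R =>
  (enorm t, thead t)) B).
  apply/measurable_fun_pairP; split; last exact: measurable_thead.
  by apply: measurable_enorm; exact: measurable_id.
have -> : B = (fun p : R * R => p.1) @^-1` `]0, 1]%classic `&`
    [set p | r * p.1 < `|p.2|].
  by apply/seteqP; split => p; rewrite /B/= in_itv.
apply: measurableI.
  by apply: measurable_preim => //; exact: measurable_fst.
rewrite -[X in measurable X]setTI; apply: measurable_fun_ltr => //.
  by apply: measurable_funM => //; exact: measurable_fst.
by apply: measurable_norm; exact: measurable_snd.
Qed.

(** The hyperplane is a null point times R^n, and 0 times a possibly infinite volume is 0. *)
Lemma vol_hyperplane (n : nat) (A : set (n.+1.-tuple R)) : measurable A ->
  A `<=` [set t | thead t = 0] -> vol n.+1 A = 0%E.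
Proof.
move=> mA A0; apply/eqP; rewrite eq_le measure_ge0 andbT.
have E : vol n.+1 [set t | [set 0] (thead t) /\ setT (ttail t)] = 0%E.
  by rewrite vol_box// lebesgue_measure_set1 mul0e.
rewrite -[leRHS]E; apply: le_measure; rewrite ?inE//.
  by apply: measurableI; apply: measurable_preim => //;
    [exact: measurable_thead|exact: measurable_ttail].
by move=> t /A0 /= ->.
Qed.

Lemma enorm_le1 (n : nat) (t : n.-tuple R) : (enorm t <= 1) = (sqnorm t <= 1).
Proof. by rewrite -sqr_enorm -[X in _ = (_ <= X)](expr1n _ 2) ler_sqr ?nnegrE//
  enorm_ge0. Qed.

Lemma enorm_gt0 (n : nat) (t : n.-tuple R) : (0 < enorm t) = (0 < sqnorm t).
Proof. by rewrite /enorm sqrtr_gt0. Qed.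

(** The missing origin is [sqball 0], which lies in a hyperplane. *)
Lemma vol_punctured_ball (n : nat) :
  vol n.+1 [set t | 0 < enorm t <= 1] = vol n.+1 (sqball 1).
Proof.
have mP : measurable [set t : n.+1.-tuple R | 0 < enorm t <= 1].
  rewrite (_ : [set _ | _] = @enorm R n.+1 @^-1` `]0, 1]%classic); last first.
    by apply/seteqP; split => x /=; rewrite in_itv.
  by apply: measurable_preim => //; apply: measurable_enorm;
    exact: measurable_id.
have mQ : measurable (sqball (n := n.+1) (0 : R)) by exact: measurable_sqball.
have -> : sqball 1 = [set t : n.+1.-tuple R | 0 < enorm t <= 1] `|` sqball 0.
  apply/seteqP; split => t; rewrite /sqball/= enorm_gt0 enorm_le1.
    by move=> ->; have [|] := ltP 0 (sqnorm t); [left|right].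
  by case=> [/andP[]//|/le_trans]; apply.
rewrite measureU//; last first.
  apply/seteqP; split => // t [/=]; rewrite /sqball/= enorm_gt0 => /andP[h _].
  by rewrite leNgt h.
rewrite [X in (_ + X)%E](_ : _ = 0%E) ?adde0//.
apply: vol_hyperplane => // t; rewrite /sqball/= sqnorm_eta.
have := sqnorm_ge0 (ttail t); have := sqr_ge0 (thead t) => h1 h2 h3.
by apply/eqP; rewrite -sqrf_eq0 eq_le h1 andbT; lra.
Qed.

Lemma vol_shift_head (n : nat) (c : R) (A : set (n.+1.-tuple R)) : measurable A
  ->
  vol n.+1 [set t | A (tcons (c + thead t, ttail t))] = vol n.+1 A.
Proof. by move=> mA; apply: (@vol_shear_head _ n (fun=> c)). Qed.

Lemma measurable_shift_head (n : nat) (c : R) (A : set (n.+1.-tuple R)) :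
  measurable A ->
  measurable [set t | A (tcons (c + thead t, ttail t))].
Proof.
move=> mA; apply: measurable_preim => //; apply: measurable_fun_tcons;
  last exact: measurable_ttail.
by apply: measurable_funD => //; exact: measurable_thead.
Qed.

(* Points of the cone at height more than r lie in the balls of radius
   b = sqrt (1 - r^2) centred at (+-r, 0); the others lie in the image under
   diag (r, b) of a double cone each half of which fits in a unit ball. *)
Lemma vol_cone_le (n : nat) (r : R) : 0 < r < 1 ->
  (vol n.+1 (cone n r) <=
   (4 * Num.sqrt (1 - r ^+ 2) ^+ n)%:E * vol n.+1 (sqball 1))%E.
Proof.
move=> /andP[r0 r1]; set b := Num.sqrt _.
have b2 : b ^+ 2 = 1 - r ^+ 2 by rewrite sqr_sqrtr//; nra.
have b0 : 0 < b by rewrite sqrtr_gt0; nra.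
have b1 : b <= 1 by rewrite -ler_sqr ?nnegrE ?(ltW b0)// b2; nra.
(* [S c rho] is the ball centred at (-c, 0) with squared radius [rho]. *)
pose S (c rho : R) := [set t : n.+1.-tuple R |
  sqball rho (tcons (c + thead t, ttail t))].
have mS c rho : measurable (S c rho).
  by apply: measurable_shift_head; exact: measurable_sqball.
have vS c rho : vol n.+1 (S c rho) = vol n.+1 (sqball rho).
  by apply: vol_shift_head; exact: measurable_sqball.
(* [D x y] is the double cone with apex at the origin, half-height x and base radius y, without its
   lateral surface. *)
pose D (x y : R) := [set t : n.+1.-tuple R |
  0 < `|thead t| <= x /\ x ^+ 2 * sqnorm (ttail t) < y ^+ 2 * thead t ^+ 2].
have mD x y : measurable (D x y).
  pose B := [set p : R * R | 0 < `|p.1| <= x /\ x ^+ 2 * p.2 < y ^+ 2 * p.1 ^+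
    2].
  apply: (@measurable_preim _ _ _ _ (fun t : n.+1.-tuple R =>
    (thead t, sqnorm (ttail t))) B).
    apply/measurable_fun_pairP; split; first exact: measurable_thead.
    by apply: measurable_dotp; exact: measurable_ttail.
  have -> : B = (fun p : R * R => `|p.1|) @^-1` `]0, x]%classic `&`
      [set p | x ^+ 2 * p.2 < y ^+ 2 * p.1 ^+ 2].
    by apply/seteqP; split => p; rewrite /B/= in_itv.
  apply: measurableI.
    by apply: measurable_preim => //; apply: measurable_norm;
      exact: measurable_fst.
  rewrite -[X in measurable X]setTI; apply: measurable_fun_ltr => //.
    by apply: measurable_funM => //; exact: measurable_snd.
  apply: measurable_funM => //; apply: measurable_funX; exact: measurable_fst.
have vD : vol n.+1 (D r b) = ((r * b ^+ n)%:E * vol n.+1 (D 1%R 1%R))%E.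
  rewrite -(vol_scale2 r0 b0 (mD r b)); congr (_ * vol n.+1 _)%E.
  apply/funext => t; rewrite /D/= theadE ttail_tcons sqnorm_tscale normrM
    (gtr0_norm r0).
  have -> : (0 < r * `|thead t| <= r) = (0 < `|thead t| <= 1).
    by rewrite pmulr_rgt0// -[X in _ && (_ <= X)]mulr1 ler_pM2l.
  rewrite expr1n !mul1r exprMn [in LHS]mulrCA ltr_pM2l ?exprn_gt0//.
  by rewrite ltr_pM2l ?exprn_gt0.
(* For 0 < x <= 1, (x - 1)^2 + x^2 <= 1, so the upper half lies in the unit ball centred at (1, 0),
   and symmetrically for the lower half. *)
have D1 : D 1 1 `<=` S (-1) 1 `|` S 1 1.
  move=> t; rewrite /D/= expr1n !mul1r => -[/andP[t0 t1] h].
  have [tge0|tlt0] := leP 0 (thead t); [left|right];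
    rewrite /S/= /sqball/= sqnorm_tcons.
    by rewrite ger0_norm// in t0 t1; nra.
  by rewrite ltr0_norm// in t0 t1; nra.
(* At height x > r, (x - r)^2 + |y|^2 <= 1 - 2 r x + r^2 < b^2. At lower heights, squaring the cone
   condition gives r^2 |y|^2 < b^2 x^2. *)
have C1 : cone n r `<=` (S (- r)%R (b ^+ 2)%R `|` S r (b ^+ 2)%R) `|` D r b.
  move=> t; rewrite /cone/= => -[/andP[t0 t1] h].
  rewrite enorm_le1 sqnorm_eta in t1.
  have [th|th] := leP `|thead t| r; [right|left].
    rewrite /D/= th andbT; split; first by apply: le_lt_trans h;
      rewrite mulr_ge0 ?enorm_ge0// ltW.
    have : (r * enorm t) ^+ 2 < `|thead t| ^+ 2.
      by rewrite ltr_sqr// nnegrE// mulr_ge0 ?enorm_ge0// ltW.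
    rewrite exprMn sqr_enorm sqnorm_eta real_normK ?num_real// b2; lra.
  have [tge0|tlt0] := leP 0 (thead t); [left|right];
    rewrite /S/= /sqball/= sqnorm_tcons b2.
    by rewrite ger0_norm// in th; nra.
  by rewrite ltr0_norm// in th; nra.
have vU (X Y : set (n.+1.-tuple R)) : measurable X -> measurable Y ->
    (vol n.+1 (X `|` Y) <= vol n.+1 X + vol n.+1 Y)%E.
  by move=> mX mY; exact: measureU2.
have h1 : (vol n.+1 (D 1%R 1%R) <= 2%:E * vol n.+1 (sqball 1))%E.
  apply: (@le_trans _ _ (vol n.+1 (S (-1)%R 1%R `|` S 1%R 1%R))).
    by apply: le_measure; rewrite ?inE//; exact: measurableU.
  apply: le_trans; first exact: vU.
  by rewrite !vS [in leRHS]vol_ball_fin [in leLHS]vol_ball_fin -EFinM -EFinD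
    lee_fin; lra.
apply: (@le_trans _ _ (vol n.+1 ((S (- r)%R (b ^+ 2)%R `|` S r (b ^+ 2)%R) `|`
  D r b))).
  apply: le_measure; rewrite ?inE//; first exact: measurable_cone.
  by apply: measurableU => //; exact: measurableU.
apply: le_trans; first by apply: vU => //; exact: measurableU.
apply: (@le_trans _ _ (vol n.+1 (S (- r)%R (b ^+ 2)%R) + vol n.+1 (S r (b ^+
  2)%R) + vol n.+1 (D r b))%E).
  by rewrite leeD2r//; exact: vU.
rewrite !vS !vol_sqball// vD.
apply: (@le_trans _ _ ((b ^+ n.+1)%:E * vol n.+1 (sqball 1) + (b ^+ n.+1)%:E *
  vol n.+1 (sqball 1) + (r * b ^+ n)%:E * (2%:E * vol n.+1 (sqball 1)))%E).
  by rewrite leeD2l// lee_pmul// lee_fin mulr_ge0 ?exprn_ge0// ltW.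
rewrite vol_ball_fin -!EFinM -!EFinD lee_fin.
(* What remains is 2 b^(n+1) + 2 r b^n <= 4 b^n, as b and r are at most 1. *)
have V0 : 0 <= fine (vol n.+1 (sqball 1)) by rewrite fine_ge0.
have p0 : 0 <= b ^+ n by rewrite exprn_ge0// ltW.
have p1 : b ^+ n.+1 <= b ^+ n by rewrite exprS ler_piMl.
have p2 : r * b ^+ n <= b ^+ n by rewrite ler_piMl// ltW.
rewrite mulrCA -!mulrDl mulrA -mulrDl; apply: ler_wpM2r => //.
clear -p1 p2; lra.
Qed.

Lemma vol_cone_eq0 (n : nat) (r : R) : 1 <= r -> vol n.+1 (cone n r) = 0%E.
Proof.
move=> r1; rewrite (_ : cone n r = set0) ?measure0//; apply/seteqP;
  split => // t.
rewrite /cone/= => -[_]; apply/negP; rewrite -leNgt.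
apply: (@le_trans _ _ (enorm t)); last by rewrite ler_peMl ?enorm_ge0.
rewrite -ler_sqr ?nnegrE ?enorm_ge0// sqr_enorm sqnorm_eta real_normK
  ?num_real//.
by rewrite lerDl sqnorm_ge0.
Qed.

(** The cone contains the cylinder over the interval from r to r' whose base has radius sqrt (1 -
    r'^2): its points have norm at most 1 and head above r. *)
Lemma vol_cone_ge (n : nat) (r r' : R) : 0 <= r -> r < r' -> r' < 1 ->
  (((r' - r) * Num.sqrt (1 - r' ^+ 2) ^+ n)%:E * vol n (sqball 1) <=
   vol n.+1 (cone n r))%E.
Proof.
move=> r0 rr' r1; set b := Num.sqrt _.
have b2 : b ^+ 2 = 1 - r' ^+ 2 by rewrite sqr_sqrtr//; nra.
have b0 : 0 < b by rewrite sqrtr_gt0; nra.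
pose C := [set t : n.+1.-tuple R |
  `]r, r']%classic (thead t) /\ sqball (b ^+ 2) (ttail t)].
have mC : measurable C.
  apply: measurableI; apply: measurable_preim => //.
  + exact: measurable_thead.
  + exact: measurable_ttail.
  + exact: measurable_sqball.
rewrite EFinM -muleA -vol_sqball// -lebesgue_oc// -vol_box//;
  last exact: measurable_sqball.
apply: le_measure; rewrite ?inE//; first exact: measurable_cone.
move=> t; rewrite /cone /sqball/= in_itv/= => -[/andP[h1 h2]]; rewrite b2 => h3.
have h4 := sqnorm_ge0 (ttail t).
rewrite enorm_le1 enorm_gt0 !sqnorm_eta; split; first by apply/andP; split; nra.
have t0 : 0 < thead t by lra.
rewrite gtr0_norm//; apply: le_lt_trans h1;
  rewrite ler_piMr// enorm_le1 sqnorm_eta.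
by nra.
Qed.

End caps.
Arguments cone {R} n r.

(** * Cap probabilities *)

Section cap_probability.
Context {R : realType}.
Notation vol n := (lebesgue_tuple R n).

(** The normalised area of a double cap of the unit sphere in R^(n+1); the dimension factor of
    [sphere_area] cancels in the ratio. *)
Definition capq (n : nat) (r : R) : R :=
  fine (vol n.+1 (cone n r)) / fine (vol n.+1 (sqball 1)).

Lemma vol_cone_leball (n : nat) (r : R) :
  (vol n.+1 (cone n r) <= vol n.+1 (sqball 1))%E.
Proof.
apply: le_measure; rewrite ?inE;
  [exact: measurable_cone|exact: measurable_sqball|].
by move=> t; rewrite /cone/= enorm_le1 => -[/andP[]].
Qed.

Lemma vol_cone_fin (n : nat) (r : R) :
  vol n.+1 (cone n r) = (fine (vol n.+1 (cone n r)))%:E.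
Proof.
rewrite fineK// ge0_fin_numE//.
exact: le_lt_trans (vol_cone_leball _ _) (vol_ball_lty _).
Qed.

Lemma fine_vol_ball_gt0 (n : nat) : 0 < fine (vol n (sqball 1)).
Proof. by rewrite fine_gt0// vol_ball_gt0 vol_ball_lty. Qed.

Lemma capq_ge0 (n : nat) (r : R) : 0 <= capq n r.
Proof. by rewrite divr_ge0// fine_ge0. Qed.

Lemma capq_le1 (n : nat) (r : R) : capq n r <= 1.
Proof.
rewrite ler_pdivrMr ?fine_vol_ball_gt0// mul1r -lee_fin -vol_cone_fin
  -vol_ball_fin.
exact: vol_cone_leball.
Qed.

(** Rotating z / |z| onto the first axis turns the event into [cone n r], so the probability does
    not depend on z. *)
Lemma uniform_cap d (Om : measurableType d) (P : probability Om R) (n : nat)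
    (L : {RV P >-> n.+1.-tuple R}) (z : n.+1.-tuple R) (r : R) :
  uniform_on_sphere L -> 0 < enorm z ->
  P (L @^-1` [set l | r * enorm z < `|dotp l z|]) = (capq n r)%:E.
Proof.
move=> uL z0; rewrite uL; last first.
  rewrite -[X in measurable X]setTI; apply: measurable_fun_ltr => //.
  by apply: measurable_norm; apply: measurable_dotp;
    [exact: measurable_id|exact: measurable_cst].
pose theta := tscale (enorm z)^-1 z.
have th1 : sqnorm theta = 1.
  by rewrite sqnorm_tscale -sqr_enorm exprVn mulVf// expf_neq0// gt_eqF.
pose B := [set p : R * R | 0 < Num.sqrt p.1 <= 1 /\ r * Num.sqrt p.1 < p.2].
have msq : measurable_fun setT (fun p : R * R => Num.sqrt p.1).
  apply: (@measurableT_comp _ _ _ _ _ _ (@Num.sqrt R));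
    last exact: measurable_fst.
  by apply: continuous_measurable_fun; exact: sqrt_continuous.
have mB : measurable B.
  have -> : B = (fun p : R * R => Num.sqrt p.1) @^-1` `]0, 1]%classic `&`
      [set p | r * Num.sqrt p.1 < p.2].
    by apply/seteqP; split => p; rewrite /B/= in_itv.
  apply: measurableI; first exact: measurable_preim.
  rewrite -[X in measurable X]setTI; apply: measurable_fun_ltr => //.
  exact: measurable_funM.
have EB := vol_rotate_norm th1 mB.
rewrite /sphere_area.
have -> : [set x : n.+1.-tuple R | 0 < enorm x <= 1 /\
    [set l | r * enorm z < `|dotp l z|] (normalize x)] =
    [set t | B (sqnorm t, `|dotp theta t|)].
  apply/funext => x; rewrite /B/= -/(enorm x).
  apply/propext; split => -[x01 h]; split => //;
    have x0 : 0 < enorm x by case/andP: x01.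
    (* [normalize x] is convertible to [tscale (enorm x)^-1 x]. *)
    rewrite [dotp _ z]dotpC (dotp_tscale (enorm x)^-1) normrM ger0_norm
      ?invr_ge0 ?enorm_ge0// in h.
    rewrite dotpC dotp_tscale normrM ger0_norm ?invr_ge0 ?enorm_ge0//
      ltr_pdivlMl//.
    by rewrite ltr_pdivlMl// in h;
      rewrite dotpC mulrC -mulrA (mulrC r) in h *; lra.
  rewrite [dotp _ z]dotpC (dotp_tscale (enorm x)^-1) normrM ger0_norm ?invr_ge0
    ?enorm_ge0//.
  rewrite dotpC dotp_tscale normrM ger0_norm ?invr_ge0 ?enorm_ge0//
    ltr_pdivlMl// in h.
  by rewrite ltr_pdivlMl// dotpC; lra.
rewrite EB.
have -> : [set t : n.+1.-tuple R | B (sqnorm t, `|thead t|)] = cone n r by [].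
have -> : [set x : n.+1.-tuple R | 0 < enorm x <= 1 /\ setT (normalize x)] =
    [set x | 0 < enorm x <= 1].
  by apply/seteqP; split => x //= -[].
rewrite vol_punctured_ball; congr (_%:E).
rewrite [X in (_ * X)%E]vol_cone_fin [X in _ / fine (_ * X)]vol_ball_fin
  -!EFinM/=.
by rewrite /capq -mulf_div divff ?mul1r// pnatr_eq0.
Qed.

(** The range r >= 1, where the cone is empty, is included because the radius (1 + delta) s may
    exceed 1. *)
Lemma capq_le (n : nat) (r : R) : (0 < n)%N -> 0 < r ->
  capq n r <= 4 * Num.sqrt (1 - r ^+ 2) ^+ n.
Proof.
move=> n0 r0; have [r1|r1] := ltP r 1.
  rewrite ler_pdivrMr ?fine_vol_ball_gt0// -lee_fin -vol_cone_fin EFinM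
    -vol_ball_fin.
  by apply: vol_cone_le; rewrite r0.
by rewrite /capq vol_cone_eq0//= mul0r mulr_ge0// exprn_ge0// sqrtr_ge0.
Qed.

(** The cylinder bound is relative to the ball of R^n; [vol_ball_ratio] converts it to the ball of
    R^(n+1). *)
Lemma capq_ge (n : nat) (r r' : R) : (0 < n)%N -> 0 <= r -> r < r' -> r' < 1 ->
  (r' - r) * Num.sqrt (1 - r' ^+ 2) ^+ n / Num.sqrt (2 * pi / n%:R) <= capq n r.
Proof.
move=> n0 r0 rr' r1; rewrite /capq ler_pdivlMr ?fine_vol_ball_gt0//.
have h0 : 0 < Num.sqrt (2 * pi / n%:R) :> R.
  by rewrite sqrtr_gt0 divr_gt0 ?ltr0n// mulr_gt0// pi_gt0.
have h1 := vol_cone_ge n r0 rr' r1; have h2 := @vol_ball_ratio R n n0.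
rewrite vol_ball_fin vol_cone_fin -EFinM lee_fin in h1.
rewrite [X in (X <= _)%E]vol_ball_fin [X in (_ * X)%E]vol_ball_fin -EFinM
  lee_fin in h2.
apply: le_trans h1; rewrite -[leLHS]mulrA; apply: ler_wpM2l.
  by rewrite mulr_ge0 ?exprn_ge0 ?sqrtr_ge0// subr_ge0 ltW.
by rewrite mulrC ler_pdivrMr// mulrC.
Qed.

End cap_probability.

(** * Cap probabilities near the critical radius *)

Section cap_asymptotics.
Context {R : realType}.

Lemma sqrt_expR (x : R) : Num.sqrt (expR x) = expR (x / 2).
Proof.
rewrite -[RHS]ger0_norm ?expR_ge0// -sqrtr_sqr -expRM_natl;
  congr (Num.sqrt (expR _)).
by field.
Qed.

(** With s^2 = 1 - exp (-t), this bounds 1 - ((1 + delta) s)^2 by a power of 1 - s^2. It follows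
    from exp (- 2 delta t) >= 1 - 2 delta t and t exp (-t) <= 1 - exp (-t). *)
Lemma onem_expR_le (delta t : R) : 0 <= delta -> 0 <= t ->
  1 - (1 + delta) ^+ 2 * (1 - expR (- t)) <= expR (- ((1 + 2 * delta) * t)).
Proof.
move=> d0 t0; have e0 := expR_gt0 (- t).
have e1 : expR (- t) <= 1 by rewrite expR_le1; lra.
rewrite (_ : - ((1 + 2 * delta) * t) = - t + - (2 * delta * t)); last by ring.
rewrite expRD; have h := expR_ge1Dx (- (2 * delta * t)).
apply: (@le_trans _ _ (expR (- t) * (1 + - (2 * delta * t))));
  last by rewrite ler_pM2l.
have : expR (- t) * (1 + t) <= 1.
  by rewrite -[leRHS](expRxMexpNx_1 t) mulrC; apply: ler_wpM2r;
    [exact: ltW|exact: expR_ge1Dx].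
move=> {}h; nra.
Qed.

Lemma onem_expR_ge (eta t : R) : 0 <= eta <= 1 -> 0 <= t ->
  expR (- ((1 - eta) * t)) <= 1 - (1 - eta) ^+ 2 * (1 - expR (- t)).
Proof.
move=> /andP[e0 e1] t0; have x0 := expR_gt0 (- t).
have x1 : expR (- t) <= 1 by rewrite expR_le1; lra.
have y0 := expR_gt0 (- ((1 - eta) * t)).
(* convexity of exp, from its tangent at - (1 - eta) t *)
have h1 : expR (- ((1 - eta) * t)) * (1 - eta * t) <= expR (- t).
  rewrite (_ : expR (- t) = expR (- ((1 - eta) * t)) * expR (- (eta * t))).
    by apply: ler_wpM2l; [exact: ltW|exact: expR_ge1Dx].
  by rewrite -expRD; congr expR; ring.
(* The same tangent, evaluated at 0. *)
have h2 : expR (- ((1 - eta) * t)) * (1 + (1 - eta) * t) <= 1.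
  rewrite -[leRHS](expRxMexpNx_1 ((1 - eta) * t)) [leRHS]mulrC.
  by apply: ler_wpM2l; [exact: ltW|exact: expR_ge1Dx].
(* With weights 1 - eta and eta the terms linear in t cancel. *)
have h : expR (- ((1 - eta) * t)) <= (1 - eta) * expR (- t) + eta.
  have e1' : 0 <= 1 - eta by lra.
  move: y0 h1 h2; move: (expR _) (expR _) => z y y0 h1 h2.
  have k1 : (1 - eta) * (y * (1 - eta * t)) <= (1 - eta) * z by exact:
    ler_wpM2l.
  have k2 : eta * (y * (1 + (1 - eta) * t)) <= eta * 1 by exact: ler_wpM2l.
  lra.
have k : 0 <= eta * ((1 - eta) * (1 - expR (- t))) by rewrite !mulr_ge0
  ?subr_ge0.
by apply: (le_trans h); lra.
Qed.

(** A rough bound is enough: exp (1/2) (1 - 1/2) <= 1 gives exp (1/2) <= 2. *)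
Lemma ln2_ge (p : nat) : (1 < p)%N -> 2^-1 <= ln p%:R :> R.
Proof.
move=> p1; have p0 : 0 < p%:R :> R by rewrite ltr0n (ltn_trans _ p1).
rewrite -ler_expR lnK ?posrE//.
have h : expR (2^-1) * (1 - 2^-1) <= 1 :> R.
  rewrite -[leRHS](expRxMexpNx_1 2^-1); apply: ler_wpM2l; first exact: expR_ge0.
  exact: expR_ge1Dx.
have : 2 <= p%:R :> R by rewrite ler_nat.
lra.
Qed.

(** The critical s of the proof idea, with p^(-2/n) written as an exponential; [max_scaleE] links it
    to [max_scale]. *)
Definition cap_radius (n p : nat) : R :=
  Num.sqrt (1 - expR (- (2 * ln p%:R / n%:R))).

Lemma sqr_cap_radius (n p : nat) : (1 < p)%N ->
  cap_radius n p ^+ 2 = 1 - expR (- (2 * ln p%:R / n%:R)).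
Proof.
move=> p1; rewrite sqr_sqrtr// subr_ge0 expR_le1 oppr_le0 divr_ge0// mulr_ge0//.
by apply: le_trans (ln2_ge p1).
Qed.

Lemma cap_radius_lt1 (n p : nat) : cap_radius n p < 1.
Proof.
rewrite -(sqrtr1 R) ltr_sqrt// ltrBlDr ltrDl; exact: expR_gt0.
Qed.

(** For t = 2 ln p / n, 1 - exp (-t) >= t / (1 + t), while n t >= 1 and n >= 1. This offsets the
    factor sqrt (2 pi / n) in the lower bound on caps, uniformly in n. *)
Lemma sqr_cap_radius_ge (n p : nat) : (0 < n)%N -> (1 < p)%N ->
  4^-1 <= n%:R * cap_radius n p ^+ 2.
Proof.
move=> n0 p1; rewrite sqr_cap_radius//; set t := 2 * ln p%:R / n%:R.
have nR : 1 <= n%:R :> R by rewrite ler1n.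
have a1 : 1 <= n%:R * t.
  by rewrite /t mulrC divfK ?gt_eqF ?ltr0n//; have := ln2_ge p1; lra.
have t0 : 0 < t by rewrite -(pmulr_rgt0 (x := n%:R)) ?ltr0n//; lra.
have e0 := expR_gt0 (- t).
have h : expR (- t) * (1 + t) <= 1.
  by rewrite -[leRHS](expRxMexpNx_1 t) mulrC; apply: ler_wpM2r;
    [exact: ltW|exact: expR_ge1Dx].
rewrite -(ler_pM2r (_ : 0 < 1 + t)); last by lra.
apply: (@le_trans _ _ (n%:R * t)); last by nra.
nra.
Qed.

Lemma cap_radius_gt0 (n p : nat) : (0 < n)%N -> (1 < p)%N -> 0 < cap_radius n p.
Proof.
move=> n0 p1; have := sqr_cap_radius_ge n0 p1;
  rewrite lt_neqAle sqrtr_ge0 andbT.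
by apply: contraTneq => <-; rewrite expr0n mulr0 -ltNge.
Qed.

(** With t = 2 ln p / n, the power n/2 of [onem_expR_le] is p^(-(1 + 2 delta)), and the factor p
    leaves p^(-2 delta). *)
Lemma capq_upper (n p : nat) (delta : R) : (0 < n)%N -> (1 < p)%N -> 0 <= delta
  ->
  p%:R * capq n ((1 + delta) * cap_radius n p) <= 4 * expR (- (2 * delta * ln
    p%:R)).
Proof.
move=> n0 p1 d0; have p0 : 0 < p%:R :> R by rewrite ltr0n (ltn_trans _ p1).
have nR : 0 < n%:R :> R by rewrite ltr0n.
have s0 := cap_radius_gt0 n0 p1.
pose t := 2 * ln p%:R / n%:R : R.
have t0 : 0 <= t by rewrite divr_ge0 ?mulr_ge0 ?ltW//;
  apply: lt_le_trans (ln2_ge p1).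
have h1 : capq n ((1 + delta) * cap_radius n p) <=
    4 * expR (- ((1 + 2 * delta) * ln p%:R)).
  apply: (le_trans (capq_le n0 _)); first by rewrite mulr_gt0// ltr_wpDr.
  apply: ler_wpM2l => //.
  rewrite (_ : - ((1 + 2 * delta) * ln p%:R) = n%:R * (- ((1 + 2 * delta) * t)
    / 2)); last first.
    by rewrite /t; field; rewrite gt_eqF.
  rewrite expRM_natl -sqrt_expR; apply: lerXn2r; rewrite ?nnegrE ?sqrtr_ge0//.
  by apply: ler_wsqrtr; rewrite exprMn sqr_cap_radius//; exact: onem_expR_le.
move: h1; rewrite -(ler_pM2l p0) => /le_trans; apply.
rewrite (_ : - ((1 + 2 * delta) * ln p%:R) = - ln p%:R + - (2 * delta * ln
  p%:R)); last by ring.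
by rewrite expRD expRN lnK ?posrE// mulrCA (mulrA p%:R) divff ?gt_eqF// mul1r.
Qed.

Lemma capq_lower (n p : nat) (delta : R) : (0 < n)%N -> (1 < p)%N -> 0 < delta
  <= 1 ->
  delta / 16 * expR (delta / 2 * ln p%:R) <=
  p%:R * capq n ((1 - delta) * cap_radius n p).
Proof.
move=> n0 p1 /andP[d0 d1];
  have p0 : 0 < p%:R :> R by rewrite ltr0n (ltn_trans _ p1).
have nR : 0 < n%:R :> R by rewrite ltr0n.
have s0 := cap_radius_gt0 n0 p1; have s1 := cap_radius_lt1 n p.
have s2 := sqr_cap_radius_ge n0 p1.
set s := cap_radius n p in s0 s1 s2 *.
pose t := 2 * ln p%:R / n%:R : R.
have t0 : 0 <= t by rewrite divr_ge0 ?mulr_ge0 ?ltW//;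
  apply: lt_le_trans (ln2_ge p1).
(* The cylinder runs between the radii (1 - delta) s and (1 - eta) s, so its height is delta s /
   2. *)
pose eta := delta / 2.
have heta : 0 <= eta <= 1 by rewrite /eta; lra.
have h1 : ((1 - eta) * s - (1 - delta) * s) * Num.sqrt (1 - ((1 - eta) * s) ^+
  2) ^+ n /
    Num.sqrt (2 * pi / n%:R) <= capq n ((1 - delta) * s).
  apply: capq_ge => //; rewrite /eta; [|nra|nra].
  by rewrite mulr_ge0 ?subr_ge0// ltW.
have h2 : expR (- ((1 - eta) * ln p%:R)) <= Num.sqrt (1 - ((1 - eta) * s) ^+ 2)
  ^+ n.
  rewrite (_ : - ((1 - eta) * ln p%:R) = n%:R * (- ((1 - eta) * t) / 2));
    last first.
    by rewrite /t; field; rewrite gt_eqF.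
  rewrite expRM_natl -sqrt_expR; apply: lerXn2r; rewrite ?nnegrE ?sqrtr_ge0//.
  by apply: ler_wsqrtr; rewrite exprMn sqr_cap_radius//; exact: onem_expR_ge.
(* From n s^2 >= 1/4 and pi < 4. *)
have h3 : 8^-1 <= s / Num.sqrt (2 * pi / n%:R).
  have q0 : 0 < 2 * pi / n%:R :> R by rewrite divr_gt0// mulr_gt0// pi_gt0.
  rewrite ler_pdivlMr ?sqrtr_gt0// -ler_sqr ?nnegrE ?mulr_ge0 ?invr_ge0
    ?sqrtr_ge0 ?(ltW s0)//.
  rewrite exprMn sqr_sqrtr ?(ltW q0)// mulrA ler_pdivrMr// [leRHS]mulrC.
  by apply: le_trans s2; have := @pihalf_lt2 R; lra.
move: h1; rewrite -(ler_pM2l p0); apply: le_trans.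
rewrite (_ : eta * ln p%:R = ln p%:R + - ((1 - eta) * ln p%:R)); last by ring.
rewrite expRD lnK ?posrE// mulrCA; apply: ler_wpM2l; first exact: ltW.
rewrite (_ : (1 - eta) * s - (1 - delta) * s = delta / 2 * s);
  last by rewrite /eta; field.
move: h2 h3; set b := Num.sqrt _ ^+ n; set c := Num.sqrt _ => h2 h3.
rewrite (_ : delta / 2 * s * b / c = delta / 2 * (s / c * b)); last by ring.
rewrite (_ : delta / 16 * _ = delta / 2 * (8^-1 * expR (- ((1 - eta) * ln
  p%:R)))); last by field.
apply: ler_wpM2l; first by rewrite divr_ge0// ltW.
by apply: ler_pM => //; exact: expR_ge0.
Qed.

End cap_asymptotics.

(** * Conditioning on the vector *)

Section conditioning.
Context {R : realType} d (Om : measurableType d) (P : probability Om R).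

(** By independence the joint law is the product of the laws, so a bound on the sections that is
    uniform in y survives integration over the law of [Y]. *)
Lemma indep_section d1 d2 (T1 : measurableType d1) (T2 : measurableType d2)
    (X : {RV P >-> T1}) (Y : {RV P >-> T2}) (E : set (T1 * T2)) (c : R) :
  (forall A B, measurable A -> measurable B ->
    (P (X @^-1` A `&` Y @^-1` B) = P (X @^-1` A) * P (Y @^-1` B))%E) ->
  measurable E ->
  (forall y, (P [set w | E (X w, y)] <= c%:E)%E) ->
  (P [set w | E (X w, Y w)] <= c%:E)%E.
Proof.
move=> ind mE Ec.
have mXY : measurable_fun setT (fun w => (X w, Y w)).
  by apply/measurable_fun_pairP; split; exact: measurable_funPT.
pose nu := measure_function_pushforward__canonical__measure_function_Measure P
  mXY.
have h1 : (distribution P X \x distribution P Y)%E E = nu E.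
  by apply: product_measure_unique => // A B mA mB;
    rewrite /= /pushforward -ind.
have h2 : (distribution P X \x distribution P Y)%E E =
    (distribution P X \x^ distribution P Y)%E E.
  by apply: product_measure_unique => // A B mA mB; exact: product_measure2E.
rewrite (_ : P _ = nu E)// -h1 h2 /product_measure2.
apply: (@le_trans _ _ (\int[distribution P Y]_y c%:E)%E).
  apply: ge0_le_integral => //.
  - exact: measurable_fun_ysection.
  - move=> y _ /=; apply: le_trans (Ec y).
    rewrite /distribution /pushforward le_eqVlt; apply/orP; left; apply/eqP.
    by congr (P _); apply/seteqP; split => w /=; rewrite ysectionE.
by rewrite integral_cst//= probability_setT mule1.
Qed.

Lemma union_bound (I : eqType) (s : seq I) (F : I -> set Om) (c : R) :
  (forall i, measurable (F i)) -> (forall i, (P (F i) <= c%:E)%E) ->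
  measurable [set w | exists2 i, i \in s & F i w] /\
  (P [set w | exists2 i, i \in s & F i w] <= ((size s)%:R * c)%:E)%E.
Proof.
move=> mF Fc; elim: s => [|x s [mI IH]].
  rewrite (_ : [set _ | _] = set0) ?measure0 ?mul0r; last by apply/seteqP;
    split => w // -[].
  by split.
have -> : [set w | exists2 i, i \in x :: s & F i w] =
    F x `|` [set w | exists2 i, i \in s & F i w].
  apply/seteqP; split => w /=.
    by move=> [i]; rewrite inE => /predU1P[->|is_ Fi]; [left|right; exists i].
  case=> [Fx|[i is_ Fi]]; first by exists x => //; rewrite mem_head.
  by exists i => //; rewrite inE is_ orbT.
split; first exact: measurableU.
apply: le_trans; first by apply: measureU2.
by rewrite /= -natr1 mulrDl mul1r addrC EFinD; exact: leeD.
Qed.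

End conditioning.

(** Stated without dividing by the norm of [z]: at z = 0 it is plainly false. *)
Definition exceeds {R : realType} (n : nat) (r : R) (l z : n.-tuple R) : bool :=
  r * enorm z < `|dotp l z|.

(** * Probabilities that some, or none, of the directions exceeds a level *)

Section maximum.
Context {R : realType} d (Om : measurableType d) (P : probability Om R).
Variables (n p : nat) (L : 'I_p -> {RV P >-> n.+1.-tuple R}).
Variable Z : {RV P >-> n.+1.-tuple R}.
Hypothesis L_uniform : forall j, uniform_on_sphere (L j).
Hypothesis L_indep : mutually_independent L.
Hypothesis LZ_indep : independent_of_family L Z.

(** Bundling the L_j into one random element allows [indep_section] to condition on [Z]. *)
Definition family_tuple (w : Om) : p.-tuple (n.+1.-tuple R) := [tuple L j w | j
  < p].

Lemma measurable_family_tuple : measurable_fun setT family_tuple.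
Proof.
apply/measurable_fun_tnthP => j; rewrite (_ : _ \o _ = L j) ?measurable_funPT//.
by apply/funext => w /=; rewrite tnth_mktuple.
Qed.

HB.instance Definition _ := isMeasurableFun.Build _ _ _ _ family_tuple
  measurable_family_tuple.

(** The sigma-algebra generated by the L_j is the pullback of the product sigma-algebra by
    [family_tuple]. *)
Lemma indep_tuple (A : set (p.-tuple (n.+1.-tuple R))) (B : set (n.+1.-tuple
  R)) :
  measurable A -> measurable B ->
  (P (family_tuple @^-1` A `&` Z @^-1` B) = P (family_tuple @^-1` A) * P (Z
    @^-1` B))%E.
Proof.
move=> mA mB; apply: LZ_indep => //.
have -> : (fun j => L j : Om -> n.+1.-tuple R) =
    (fun j => (@tnth p (n.+1.-tuple R))^~ j \o family_tuple).
  by apply/funext => j; apply/funext => w /=; rewrite tnth_mktuple.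
rewrite g_sigma_preimage_comp; exists A => //; exact: setTI.
Qed.

Lemma measurable_exceeds (r : R) dd (T : measurableType dd) (f g : T ->
  n.+1.-tuple R) :
  measurable_fun setT f -> measurable_fun setT g ->
  measurable [set x | exceeds r (f x) (g x)].
Proof.
move=> mf mg; rewrite -[X in measurable X]setTI;
  apply: measurable_fun_ltr => //.
  by apply: measurable_funM => //; exact: measurable_enorm.
by apply: measurable_norm; exact: measurable_dotp.
Qed.

(** Given Z = z, each index exceeds with probability at most q; the union bound sums over the
    indices. *)
Lemma prob_some_exceeds (r : R) : 0 <= r ->
  measurable [set w | exists j, exceeds r (L j w) (Z w)] /\
  (P [set w | exists j, exceeds r (L j w) (Z w)] <= (p%:R * capq n r)%:E)%E.
Proof.
move=> r0.
have mj j : measurable [set w | exceeds r (L j w) (Z w)].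
  by apply: measurable_exceeds; exact: measurable_funPT.
have Pj j : (P [set w | exceeds r (L j w) (Z w)] <= (capq n r)%:E)%E.
  pose E := [set q : p.-tuple (n.+1.-tuple R) * n.+1.-tuple R | exceeds r (tnth
    q.1 j) q.2].
  have mE : measurable E.
    apply: measurable_exceeds; last exact: measurable_snd.
    by apply: (@measurableT_comp _ _ _ _ _ _ (fun x => tnth x j)) => //;
      exact: measurable_tnth.
  have := @indep_section _ _ _ P _ _ _ _ family_tuple Z E (capq n r)
    indep_tuple mE.
  rewrite (_ : [set w | E (family_tuple w, Z w)] = [set w | exceeds r (L j w)
    (Z w)]); last first.
    by apply/funext => w; rewrite /E/= tnth_mktuple.
  apply => z; rewrite (_ : [set _ | _] = L j @^-1` [set l | exceeds r l z]);
    last first.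
    by apply/funext => w; rewrite /E/= tnth_mktuple.
  have [z0|z0] := ltP 0 (enorm z); first by rewrite uniform_cap.
  (* For z = 0 all inner products vanish and the event is empty. *)
  rewrite (_ : _ @^-1` _ = set0) ?measure0 ?lee_fin ?capq_ge0//.
  have {}z0 : enorm z = 0 by apply/eqP; rewrite eq_le z0 enorm_ge0.
  apply/seteqP; split => // w /=; rewrite /exceeds z0 mulr0.
  have z_i i : tnth z i = 0.
    have h : sqnorm z = 0 by rewrite -sqr_enorm z0 expr0n.
    have sq0 k : true -> 0 <= tnth z k * tnth z k by rewrite -expr2 sqr_ge0.
    have := psumr_eq0P (P := xpredT) sq0 h (i := i) isT.
    by move/eqP; rewrite mulf_eq0 orbb => /eqP.
  by rewrite /dotp big1 ?normr0 ?ltxx// => i _; rewrite z_i mulr0.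
have [mU PU] := union_bound (enum 'I_p) mj Pj.
rewrite size_enum_ord in PU.
rewrite (_ : [set w | exists j, _] = [set w | exists2 i, i \in enum 'I_p &
  exceeds r (L i w) (Z w)])//.
by apply/seteqP; split => w /= [j]; exists j => //; rewrite mem_enum.
Qed.

(** Given Z = z, independence yields (1 - q)^p <= exp (- p q) <= 1 / (p q). The event must require Z
    to be nonzero, because nothing exceeds at Z = 0. *)
Lemma prob_none_exceeds (r : R) : 0 < p%:R * capq n r ->
  measurable [set w | 0 < enorm (Z w) /\ forall j, ~ exceeds r (L j w) (Z w)] /\
  (P [set w | (0 < enorm (Z w))%R /\ forall j, ~ exceeds r (L j w) (Z w)] <=
   ((p%:R * capq n r)^-1)%:E)%E.
Proof.
move=> q0.
pose E := [set q : p.-tuple (n.+1.-tuple R) * n.+1.-tuple R |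
  0 < enorm q.2 /\ forall j, ~ exceeds r (tnth q.1 j) q.2].
have mE : measurable E.
  rewrite (_ : E = [set q | 0 < enorm q.2] `&`
    \bigcap_(j in [set: 'I_p]) ~` [set q | exceeds r (tnth q.1 j) q.2]);
      last first.
    by apply/seteqP; split => q /= [? h]; split => // j; [move=> _;
      exact: h|exact: h].
  apply: measurableI.
    rewrite -[X in measurable X]setTI; apply: measurable_fun_ltr => //.
    by apply: measurable_enorm; exact: measurable_snd.
  apply: fin_bigcap_measurable => [|j _]; first exact: finite_finset.
  apply: measurableC; apply: measurable_exceeds; last exact: measurable_snd.
  by apply: (@measurableT_comp _ _ _ _ _ _ (fun x => tnth x j)) => //;
    exact: measurable_tnth.
have EE z : [set w | E (family_tuple w, z)] =
    [set w | 0 < enorm z /\ forall j, ~ exceeds r (L j w) z].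
  by apply/seteqP; split => w /= [? h]; split => // j; have := h j;
    rewrite tnth_mktuple.
rewrite (_ : [set w | _ /\ _] = [set w | E (family_tuple w, Z w)]); last first.
  by apply/seteqP; split => w /= [? h]; split => // j; have := h j;
    rewrite tnth_mktuple.
split.
  apply: (@measurable_preim _ _ _ _ (fun w => (family_tuple w, Z w)) E) => //.
  by apply/measurable_fun_pairP; split;
    [exact: measurable_family_tuple|exact: measurable_funPT].
apply: (@indep_section _ _ _ P _ _ _ _ family_tuple Z E) => //;
  first exact: indep_tuple.
move=> z; rewrite EE; have [z0|z0] := ltP 0 (enorm z); last first.
  rewrite (_ : [set _ | _] = set0) ?measure0 ?lee_fin ?invr_ge0 ?(ltW q0)//.
  by apply/seteqP; split => w //= -[].
pose A := ~` [set l | exceeds r l z].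
have mA : measurable A.
  by apply: measurableC; apply: measurable_exceeds;
    [exact: measurable_id|exact: measurable_cst].
have -> : [set w | true /\ forall j, ~ exceeds r (L j w) z] =
    \bigcap_(i in [set i | i \in [set: 'I_p]%SET]) (L i @^-1` A).
  apply/seteqP; split => w /=; first by move=> [_ h] j _; exact: h.
  by move=> h; split => // j; apply: h; rewrite /= finset.in_setT.
rewrite (L_indep [set: 'I_p]%SET (A := fun=> A))//.
have PA j : P (L j @^-1` A) = (1 - capq n r)%:E.
  rewrite /A preimage_setC probability_setC ?uniform_cap//.
  by apply: measurable_exceeds; [exact: measurable_funPT|exact: measurable_cst].
under eq_bigr do rewrite PA.
have iterE k (x : R) : iter k (fun y => x%:E * y)%E 1%E = (x ^+ k)%:E.
  by elim: k => //= k ->; rewrite exprS EFinM.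
rewrite big_const finset.cardsT card_ord iterE lee_fin.
have h : 1 - capq n r <= expR (- capq n r) by exact: expR_ge1Dx.
apply: (@le_trans _ _ (expR (- capq n r) ^+ p)).
  by apply: lerXn2r; rewrite ?nnegrE ?expR_ge0// subr_ge0 capq_le1.
rewrite -expRM_natl mulrN expRN lef_pV2 ?posrE ?expR_gt0//.
by have := expR_ge1Dx (p%:R * capq n r); lra.
Qed.

End maximum.

(** * Normalisation and the deterministic part of the estimate *)

Section concentration.
Context {R : realType}.

(** With d = n + 1 the exponent 2 / (d - 1) is 2 / n, and p > 0 selects the exponential branch of
    [powR]. *)
Lemma max_scaleE (u : R) (p n : nat) : 0 < u -> (0 < p)%N ->
  max_scale u p n.+1 = Num.sqrt u * cap_radius n p.
Proof.
move=> u0 p0; rewrite /max_scale sqrtrM ?(ltW u0)//;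
  congr (_ * Num.sqrt (1 - _)).
rewrite /powR pnatr_eq0 -[(p == 0)%N]negbK -lt0n p0/=; congr expR.
rewrite (_ : n.+1%:R - 1 = n%:R :> R); first by ring.
by rewrite -[n.+1]addn1 natrD addrK.
Qed.

(** The maximum is seeded with 0, so a negative [a] would be exceeded even by an empty family. *)
Lemma max_abs_dotp_gt (d p : nat) (l : 'I_p -> d.-tuple R) (z : d.-tuple R) (a
  : R) :
  0 <= a -> a < max_abs_dotp l z -> exists j, a < `|dotp (l j) z|.
Proof.
move=> a0; apply: contraPP => /forallNP h; apply/negP; rewrite -leNgt.
apply: bigmax_le => // j _; rewrite leNgt; apply/negP; exact: h.
Qed.

Lemma max_abs_dotp_ge (d p : nat) (l : 'I_p -> d.-tuple R) (z : d.-tuple R) j :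
  `|dotp (l j) z| <= max_abs_dotp l z.
Proof. exact: le_bigmax. Qed.

(** Both M / (s N) and N / sqrt u are within delta / 3 of 1, and for delta <= 1, (1 + delta / 3)^2
    <= 1 + delta and (1 - delta / 3)^2 >= 1 - delta. *)
Lemma ratio_within (delta S N M u s : R) : 0 < delta <= 1 -> 0 < u -> 0 < s ->
  0 <= N -> N ^+ 2 = S -> `|S / u - 1| <= delta / 3 ->
  (1 - delta / 3) * s * N <= M -> M <= (1 + delta / 3) * s * N ->
  `|M / (Num.sqrt u * s) - 1| <= delta.
Proof.
move=> /andP[d0 d1] u0 s0 N0 NS Su M1 M2.
have q0 : 0 < Num.sqrt u by rewrite sqrtr_gt0.
pose y := N / Num.sqrt u.
have y0 : 0 <= y by rewrite divr_ge0// ltW.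
have y2 : y ^+ 2 = S / u by rewrite expr_div_n sqr_sqrtr ?(ltW u0)// NS.
move: Su; rewrite -y2 ler_norml => /andP[Su1 Su2].
pose x := M / (Num.sqrt u * s).
have xE : M = x * (Num.sqrt u * s) by rewrite /x divfK// mulf_neq0// gt_eqF.
have NE : N = y * Num.sqrt u by rewrite /y divfK// gt_eqF.
have x1 : (1 - delta / 3) * y <= x.
  rewrite -(ler_pM2r (_ : 0 < Num.sqrt u * s)) ?mulr_gt0// -xE.
  by apply: le_trans M1; rewrite NE le_eqVlt; apply/orP; left; apply/eqP; ring.
have x2 : x <= (1 + delta / 3) * y.
  rewrite -(ler_pM2r (_ : 0 < Num.sqrt u * s)) ?mulr_gt0// -xE.
  by apply: (le_trans M2); rewrite NE le_eqVlt; apply/orP; left; apply/eqP;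
    ring.
have y1 : 1 - delta / 3 <= y by nra.
have y3 : y <= 1 + delta / 3 by nra.
rewrite -/x ler_norml; apply/andP; split; nra.
Qed.

End concentration.

(** * Bound on the deviation of the maximum for fixed p and d *)

Section max_concentration.
Context {R : realType} d (Om : measurableType d) (P : probability Om R).
Variables (n p : nat) (L : 'I_p -> {RV P >-> n.+1.-tuple R}).
Variable Z : {RV P >-> n.+1.-tuple R}.
Hypothesis L_uniform : forall j, uniform_on_sphere (L j).
Hypothesis L_indep : mutually_independent L.
Hypothesis LZ_indep : independent_of_family L Z.

Lemma measurable_max_abs_dotp :
  measurable_fun setT (fun w => max_abs_dotp (fun j => L j w) (Z w)).
Proof.
rewrite /max_abs_dotp; elim: (index_enum _) => [|j s IH].
  by under eq_fun do rewrite big_nil; exact: measurable_cst.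
under eq_fun do rewrite big_cons.
apply: measurable_maxr => //.
by apply: measurable_norm; apply: measurable_dotp; exact: measurable_funPT.
Qed.

(** With e = delta / 3, a deviation forces one of three events: the squared norm is off, some index
    exceeds (1 + e) s, or none exceeds (1 - e) s. *)
Lemma max_concentration (u delta : R) : (0 < n)%N -> (1 < p)%N -> 0 < u ->
  0 < delta <= 1 ->
  (P [set w | (delta <
      `|max_abs_dotp (fun j => L j w) (Z w) / max_scale u p n.+1 - 1|)%R] <=
   P [set w | (delta / 3 < `|sqnorm (Z w) / u - 1|)%R] +
   (4 * expR (- (2 * (delta / 3) * ln p%:R)) +
    16 / (delta / 3) * expR (- (delta / 3 / 2 * ln p%:R)))%:E)%E.
Proof.
move=> n0 p1 u0 d01; have /andP[d0 d1] := d01.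
have s0 : 0 < cap_radius n p :> R by exact: cap_radius_gt0.
pose e := delta / 3.
have e01 : 0 < e <= 1 by rewrite /e; lra.
have e0 : 0 <= e by rewrite /e; lra.
have r0 : 0 <= (1 + e) * cap_radius n p by rewrite mulr_ge0 ?addr_ge0// ltW.
have [mU PU] := prob_some_exceeds L_uniform LZ_indep r0.
have hq := capq_lower n0 p1 e01.
have q0 : 0 < e / 16 * expR (e / 2 * ln p%:R).
  by rewrite mulr_gt0 ?expR_gt0//; move: e01; lra.
have [mN PN] := prob_none_exceeds L_uniform L_indep LZ_indep (lt_le_trans q0
  hq).
set U := [set w | exists j, _] in mU PU.
set N := [set w | _ /\ _] in mN PN.
pose S := [set w | e < `|sqnorm (Z w) / u - 1|].
have mS : measurable S.
  rewrite -[X in measurable X]setTI; apply: measurable_fun_ltr => //.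
  apply: measurable_norm; apply: measurable_funB => //;
    apply: measurable_funM => //.
  by apply: measurable_dotp; exact: measurable_funPT.
set A := [set w | delta < _].
have mA : measurable A.
  rewrite -[X in measurable X]setTI; apply: measurable_fun_ltr => //.
  apply: measurable_norm; apply: measurable_funB => //;
    apply: measurable_funM => //.
  exact: measurable_max_abs_dotp.
have AS : A `<=` S `|` (U `|` N).
  move=> w Aw; apply: contrapT => /not_orP[nS /not_orP[nU nN]].
  move: Aw; rewrite /A/=; apply/negP; rewrite -leNgt max_scaleE//;
    last exact: ltnW.
  have Sw : `|sqnorm (Z w) / u - 1| <= e by rewrite leNgt; apply/negP.
  (* The event [N] includes a nonzero norm, which closeness of |Z|^2 / u to 1 supplies. *)
  have N0 : 0 < enorm (Z w).
    rewrite enorm_gt0; move: Sw; rewrite ler_norml => /andP[Sw _].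
    have : 0 < sqnorm (Z w) / u by move: Sw; rewrite /e; lra.
    by rewrite pmulr_lgt0// invr_gt0.
  apply: (ratio_within d01 u0 s0 (enorm_ge0 (Z w)) (sqr_enorm (Z w)) Sw).
    rewrite leNgt; apply/negP => h; apply: nN; split => // j.
    apply/negP; rewrite /exceeds -leNgt; apply: le_trans (ltW h).
    exact: (max_abs_dotp_ge (fun j => L j w)).
  rewrite leNgt; apply/negP => h; apply: nU.
  apply: (max_abs_dotp_gt _ h).
  by rewrite mulr_ge0 ?enorm_ge0// mulr_ge0 ?(ltW s0)// addr_ge0// -/e.
apply: (@le_trans _ _ (P (S `|` (U `|` N)))).
  by apply: le_measure; rewrite ?inE//; repeat apply: measurableU.
apply: le_trans; first by apply: measureU2 => //; exact: measurableU.
apply: leeD => //; apply: le_trans; first exact: measureU2.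
rewrite EFinD; apply: leeD.
  by apply: (le_trans PU); rewrite lee_fin; exact: capq_upper.
apply: (le_trans PN); rewrite lee_fin.
apply: (@le_trans _ _ (e / 16 * expR (e / 2 * ln p%:R))^-1).
  by rewrite lef_pV2 ?posrE//; exact: lt_le_trans q0 hq.
by rewrite invfM invf_div expRN.
Qed.

End max_concentration.

(** * Concentration of the standard normal law *)

Section gaussian.
Context {R : realType}.
Notation lambda := (@lebesgue_measure R).
Notation vol n := (lebesgue_tuple R n).

(** The density of the centred normal law on R^d with covariance s^2 I. *)
Definition gaussian_pdf (d : nat) (s : R) (z : d.-tuple R) : R :=
  (Num.sqrt (2 * pi * s ^+ 2) ^- d) * expR (- sqnorm z / (2 * s ^+ 2)).

Lemma gaussian_pdf_ge0 d s (z : d.-tuple R) : 0 <= gaussian_pdf s z.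
Proof. by rewrite mulr_ge0 ?expR_ge0// invr_ge0 exprn_ge0 ?sqrtr_ge0. Qed.

Lemma measurable_gaussian_pdf d s : measurable_fun setT (@gaussian_pdf d s).
Proof.
apply: measurable_funM => //; apply: measurableT_comp => //.
apply: measurable_funM => //; apply: measurable_funN; exact: measurable_sqnorm.
Qed.

Lemma gaussian_pdf_tcons d s x (y : d.-tuple R) : s != 0 ->
  gaussian_pdf s (tcons (x, y)) = normal_pdf 0 s x * gaussian_pdf s y.
Proof.
move=> s0; rewrite centered_normal_pdfE// /gaussian_pdf sqnorm_tcons.
rewrite (_ : - _ / _ = - x ^+ 2 / (2 * s ^+ 2) + - sqnorm y / (2 * s ^+ 2));
  last by ring.
by rewrite expRD exprS invfM; ring.
Qed.

Lemma integral_vol_tcons d (f : d.+1.-tuple R -> \bar R) :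
  measurable_fun setT f -> (forall t, 0 <= f t)%E ->
  (\int[vol d.+1]_t f t = \int[lambda]_x \int[vol d]_y f (tcons (x, y)))%E.
Proof.
move=> mf f0; rewrite -(@fubini_tonelli1 _ _ _ _ _ lambda (vol d) (f \o @tcons
  R d))//; last 2 first.
- by apply: measurableT_comp => //; exact: measurable_tcons.
- by move=> x; exact: f0.
transitivity (\int[pushforward (lambda \x vol d) (@tcons R d)]_t f t)%E.
  by [].
rewrite ge0_integral_pushforward ?preimage_setT//; exact: measurable_tcons.
Qed.

(** Induction on d by Tonelli, as the density factors over head and tail; in dimension 0 the measure
    is a unit mass and the density is 1. *)
Lemma integral_gaussian_pdf d s : s != 0 ->
  (\int[vol d]_z (gaussian_pdf s z)%:E = 1)%E.
Proof.
move=> s0; elim: d => [|d IH].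
  rewrite integral_dirac//.
    rewrite diracE mem_set// mul1e /gaussian_pdf /sqnorm /dotp big_ord0.
    by rewrite expr0 invr1 oppr0 mul0r expR0 mulr1.
  by apply/measurable_EFinP; exact: measurable_gaussian_pdf.
rewrite integral_vol_tcons; last 2 first.
- by apply/measurable_EFinP; exact: measurable_gaussian_pdf.
- by move=> t; rewrite lee_fin gaussian_pdf_ge0.
rewrite -(@integral_normal_pdf R 0 s); apply: eq_integral => x _.
under eq_integral do rewrite gaussian_pdf_tcons// EFinM.
rewrite ge0_integralZl//; last 3 first.
- by apply/measurable_EFinP; exact: measurable_gaussian_pdf.
- by move=> y _; rewrite lee_fin gaussian_pdf_ge0.
- by rewrite lee_fin normal_pdf_ge0.
by rewrite IH mule1.
Qed.

(** The cost per coordinate of changing the variance from 1 to 1 + x; its logarithm (ln (1 + x) - x)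
    / 2 is negative unless x = 0. *)
Definition gaussian_rate (x : R) : R := Num.sqrt (1 + x) * expR (- x / 2).

(* Change of measure to the centred normal law of variance 1 + x. *)
Lemma gaussian_pdf_le d (x : R) (z : d.-tuple R) : -1 < x ->
  x * ((1 + x) * d%:R) <= x * sqnorm z ->
  gaussian_pdf 1 z <= gaussian_rate x ^+ d * gaussian_pdf (Num.sqrt (1 + x)) z.
Proof.
move=> x1 h; have x0 : 0 < 1 + x by lra.
rewrite /gaussian_pdf /gaussian_rate expr1n sqr_sqrtr ?(ltW x0)// !mulr1.
rewrite [Num.sqrt (_ * (1 + x))]sqrtrM ?mulr_ge0 ?pi_ge0//.
rewrite !exprMn invfM -expRM_natl.
set a := Num.sqrt (1 + x) ^+ d; set b := Num.sqrt (2 * pi) ^- d.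
have a0 : a != 0 by rewrite expf_neq0// gt_eqF// sqrtr_gt0.
rewrite [leRHS](_ : _ = b * (expR (d%:R * (- x / 2)) * expR (- sqnorm z / (2 *
  (1 + x))))); last first.
  by field.
apply: ler_wpM2l; first by rewrite invr_ge0 exprn_ge0// sqrtr_ge0.
rewrite -expRD ler_expR -(ler_pM2r (_ : 0 < 2 * (1 + x))) ?mulr_gt0//.
rewrite [leRHS](_ : _ = - (x * ((1 + x) * d%:R)) - sqnorm z); last first.
  by field; rewrite gt_eqF.
by lra.
Qed.

Lemma gaussian_rate_lt1 (x : R) : -1 < x -> x != 0 -> `|gaussian_rate x| < 1.
Proof.
move=> x1 x0; have x2 : 0 < 1 + x by lra.
rewrite ger0_norm ?mulr_ge0 ?sqrtr_ge0 ?expR_ge0//.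
rewrite -ltr_sqr ?nnegrE ?mulr_ge0 ?sqrtr_ge0 ?expR_ge0//.
rewrite exprMn sqr_sqrtr ?(ltW x2)// -expRM_natl expr1n.
rewrite (_ : 2 * _ = - x); last by field.
by rewrite expRN ltr_pdivrMr ?expR_gt0// mul1r expR_gt1Dx.
Qed.

(** The factor x on both sides covers both tails: |z|^2 >= (1 + x) d for x > 0, and the reverse for
    x < 0. On this event the density is at most the rate to the power d times a density of integral
    1. *)
Lemma standard_normal_tail dd (Om : measurableType dd) (P : probability Om R)
    (d : nat) (Z : {RV P >-> d.-tuple R}) (x : R) :
  standard_normal Z -> -1 < x ->
  (P (Z @^-1` [set z | (x * ((1 + x) * d%:R) <= x * sqnorm z)%R]) <=
   (gaussian_rate x ^+ d)%:E)%E.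
Proof.
move=> [_ Zd] x1; set A := [set z | _].
have mA : measurable A.
  rewrite -[X in measurable X]setTI; apply: measurable_fun_ler => //.
  by apply: measurable_funM => //; exact: measurable_sqnorm.
have c0 : 0 <= gaussian_rate x by rewrite mulr_ge0 ?sqrtr_ge0 ?expR_ge0.
have s0 : Num.sqrt (1 + x) != 0 by rewrite gt_eqF// sqrtr_gt0; lra.
have mg s D : measurable_fun D (fun z : d.-tuple R => (gaussian_pdf s z)%:E).
  by apply/measurable_EFinP; apply: measurable_funTS;
    exact: measurable_gaussian_pdf.
rewrite Zd//.
apply: (@le_trans _ _ (\int[vol d]_(z in A)
    ((gaussian_rate x ^+ d)%:E * (gaussian_pdf (Num.sqrt (1 + x)) z)%:E))%E).
  apply: ge0_le_integral => //.
  - apply: eq_measurable_fun (mg 1 A) => z _ /=.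
    by rewrite /gaussian_pdf expr1n !mulr1.
  - by apply: measurable_funeM; exact: mg.
  - move=> z Az; rewrite -EFinM lee_fin.
    by have := gaussian_pdf_le x1 Az;
      rewrite [leLHS]/gaussian_pdf expr1n !mulr1.
rewrite ge0_integralZl//; last 2 first.
- by move=> z _; rewrite lee_fin gaussian_pdf_ge0.
- by rewrite lee_fin exprn_ge0.
rewrite -[leRHS]mule1 -(integral_gaussian_pdf d s0).
apply: lee_wpmul2l; first by rewrite lee_fin exprn_ge0.
by apply: ge0_subset_integral => // z _; rewrite lee_fin gaussian_pdf_ge0.
Qed.

Lemma standard_normal_concentration dd (Om : measurableType dd)
    (P : probability Om R) (d : nat) (Z : {RV P >-> d.-tuple R}) (e : R) :
  (0 < d)%N -> standard_normal Z -> 0 < e < 1 ->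
  (P [set w | (e < `|sqnorm (Z w) / d%:R - 1|)%R] <=
   (gaussian_rate e ^+ d + gaussian_rate (- e) ^+ d)%:E)%E.
Proof.
move=> d0 Zn /andP[e0 e1]; have dR : 0 < d%:R :> R by rewrite ltr0n.
pose A x := Z @^-1` [set z | x * ((1 + x) * d%:R) <= x * sqnorm z].
have mA x : measurable (A x).
  rewrite -[X in measurable X]setTI; apply: measurable_fun_ler => //.
  by apply: measurable_funM => //; apply: measurable_dotp;
    exact: measurable_funPT.
apply: (@le_trans _ _ (P (A e `|` A (- e)))).
  apply: le_measure; rewrite ?inE; last first.
  - move=> w /=; rewrite ltNge ler_norml negb_and -!ltNge => /orP[h|h];
    [right|left]; rewrite /A/=.
      have : sqnorm (Z w) / d%:R <= 1 - e by lra.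
      by rewrite ler_pdivrMr// => k; rewrite !mulNr lerN2 ler_pM2l.
    have : 1 + e <= sqnorm (Z w) / d%:R by lra.
    by rewrite ler_pdivlMr// => k; rewrite ler_pM2l.
  - exact: measurableU.
  - rewrite -[X in measurable X]setTI; apply: measurable_fun_ltr => //.
    apply: measurable_norm; apply: measurable_funB => //;
      apply: measurable_funM => //.
    by apply: measurable_dotp; exact: measurable_funPT.
apply: le_trans; first exact: measureU2.
by rewrite EFinD; apply: leeD; apply: standard_normal_tail => //; lra.
Qed.

End gaussian.

(** * Limits *)

Section limits.
Context {R : realType}.

Lemma cvg_expR_ln (a : R) : 0 < a ->
  expR (- (a * ln p%:R)) @[p --> \oo] --> (0 : R).
Proof.
move=> a0; apply: (@cvg_comp _ _ _ (fun p => a * ln p%:R) (fun x => expR (- x))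
  _ +oo%R); last exact: cvgr_expR.
apply/cvgryPge => A; near=> p.
rewrite -ler_pdivrMl// -ler_expR lnK.
  by near: p; exact: nbhs_infty_ger.
by rewrite posrE ltr0n; near: p; exact: nbhs_infty_gt.
Unshelve. all: end_near. Qed.

(** Common to both claims of the theorem, which differ only in how the joint convergence of |Z|^2 /
    u_d is obtained. *)
Lemma cvg_in_probability_max
    (dsp : nat -> nat -> measure_display)
    (Om : forall p d : nat, measurableType (dsp p d))
    (P : forall p d : nat, probability (Om p d) R)
    (L : forall p d : nat, 'I_p -> {RV (P p d) >-> d.-tuple R})
    (Z : forall p d : nat, {RV (P p d) >-> d.-tuple R})
    (u : nat -> R) :
  (forall p d : nat, (0 < p)%N -> (0 < d)%N ->
     forall j : 'I_p, uniform_on_sphere (L p d j)) ->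
  (forall p d : nat, (0 < p)%N -> (0 < d)%N -> mutually_independent (L p d)) ->
  (forall p d : nat, (0 < p)%N -> (0 < d)%N ->
     independent_of_family (L p d) (Z p d)) ->
  (forall d, (0 < d)%N -> 0 < u d) ->
  (forall e : R, 0 < e < 1 ->
     P pd.1 pd.2 [set w | e < `|sqnorm (Z pd.1 pd.2 w) / u pd.2 - 1|]
       @[pd --> filter_prod \oo \oo] --> 0%E) ->
  cvg_in_probability (filter_prod \oo \oo)
    (fun pd : nat * nat => P pd.1 pd.2)
    (fun pd w =>
       max_abs_dotp (fun j => L pd.1 pd.2 j w) (Z pd.1 pd.2 w) /
       max_scale (u pd.2) pd.1 pd.2)
    1.
Proof.
move=> Lu Li LZ u0 cvgZ delta delta0.
(* The estimate for fixed p and d takes a deviation of at most 1; lowering delta only enlarges the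
   event. *)
pose e := Num.min delta 1.
have e01 : 0 < e <= 1 by rewrite /e lt_min delta0 ltr01 ge_min lexx orbT.
have e3 : 0 < e / 3 < 1 by lra.
pose g (p : nat) : R := 4 * expR (- (2 * (e / 3) * ln p%:R)) +
  16 / (e / 3) * expR (- (e / 3 / 2 * ln p%:R)).
have cvgg : g pd.1 @[pd --> filter_prod \oo (\oo : set_system nat)] --> (0 : R).
  apply: (@cvg_comp _ _ _ (fst : nat * nat -> nat) g _ \oo);
    first exact: cvg_fst.
  have : g p @[p --> \oo] --> (4 * 0 + 16 / (e / 3) * 0 : R).
    by apply: cvgD; apply: cvgMr; apply: cvg_expR_ln; lra.
  by rewrite !mulr0 addr0.
have cvgb : (P pd.1 pd.2 [set w | (e / 3 < `|sqnorm (Z pd.1 pd.2 w) / u pd.2 -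
  1|)%R] +
    (g pd.1)%:E)%E @[pd --> filter_prod \oo \oo] --> 0%E.
  rewrite -[X in _ --> X]adde0; apply: cvgeD => //; first exact: cvgZ.
  by apply: cvg_EFin; [exact: nearW|exact: cvgg].
apply: (@squeeze_cvge _ _ _ _ (cst 0%E) _ _ _ 0%E _ cvgb); last exact: cvg_cst.
exists ([set p | (1 < p)%N], [set d | (1 < d)%N]) => /=.
  by split; exact: nbhs_infty_gt.
(* Since d > 1, d is [n.+2] and the exponent d - 1 in the cap estimates is positive. *)
move=> [p [|[|n]]] [/= p1 d1]//; rewrite measure_ge0/=.
have p0 : (0 < p)%N by exact: ltnW.
have Lu' := Lu p n.+2 p0 isT; have Li' := Li p n.+2 p0 isT.
have LZ' := LZ p n.+2 p0 isT.
apply: le_trans (max_concentration Lu' Li' LZ' (isT : (0 < n.+1)%N) p1 (u0 n.+2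
  isT) e01).
have mA c : measurable [set w | c < `|max_abs_dotp (fun j =>
  L p n.+2 j w) (Z p n.+2 w) /
    max_scale (u n.+2) p n.+2 - 1|].
  rewrite -[X in measurable X]setTI; apply: measurable_fun_ltr => //.
  apply: measurable_norm; apply: measurable_funB => //;
    apply: measurable_funM => //.
  exact: measurable_max_abs_dotp.
apply: le_measure; rewrite ?inE// => w /=; apply: le_lt_trans.
by rewrite ge_min lexx.
Qed.

End limits.

Theorem theorem5 (R : realType)
    (dsp : nat -> nat -> measure_display)
    (Om : forall p d : nat, measurableType (dsp p d))
    (P : forall p d : nat, probability (Om p d) R)
    (L : forall p d : nat, 'I_p -> {RV (P p d) >-> d.-tuple R})
    (Z : forall p d : nat, {RV (P p d) >-> d.-tuple R})
    (L_uniform : forall p d : nat, (0 < p)%N -> (0 < d)%N ->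
       forall j : 'I_p, uniform_on_sphere (L p d j))
    (L_indep : forall p d : nat, (0 < p)%N -> (0 < d)%N ->
       mutually_independent (L p d))
    (LZ_indep : forall p d : nat, (0 < p)%N -> (0 < d)%N ->
       independent_of_family (L p d) (Z p d)) :
  (forall (u v : nat -> R)
      (dspF : measure_display) (OmF : measurableType dspF)
      (PF : probability OmF R) (Finfty : {RV PF >-> R}),
    (forall p d : nat, (0 < p)%N -> (0 < d)%N ->
       elliptically_contoured (Z p d)) ->
    (forall p p' d : nat, (0 < p)%N -> (0 < p')%N -> (0 < d)%N ->
       forall A : set R, measurable A ->
         P p d [set w | A (enorm (Z p d w))] =
         P p' d [set w | A (enorm (Z p' d w))]) ->
    (forall d : nat, 0 < u d) ->
    (forall d : nat, 0 < v d) ->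
    (forall p : nat, (0 < p)%N ->
       cvg_in_distribution
         (fun d : nat =>
            [the {mfun _ >-> _} of centered_sqnorm (u d) (v d) \o Z p d]
              : {RV (P p d) >-> R})
         Finfty) ->
    (forall p : nat, (0 < p)%N ->
       cvg_in_probability \oo (P p)
         (fun d w => sqnorm (Z p d w) / u d) 1) ->
    cvg_in_probability (filter_prod \oo \oo)
      (fun pd : nat * nat => P pd.1 pd.2)
      (fun pd w =>
         max_abs_dotp (fun j => L pd.1 pd.2 j w) (Z pd.1 pd.2 w) /
         max_scale (u pd.2) pd.1 pd.2)
      1)
  /\
  ((forall p d : nat, (0 < p)%N -> (0 < d)%N -> standard_normal (Z p d)) ->
    cvg_in_probability (filter_prod \oo \oo)
      (fun pd : nat * nat => P pd.1 pd.2)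
      (fun pd w =>
         max_abs_dotp (fun j => L pd.1 pd.2 j w) (Z pd.1 pd.2 w) /
         max_scale (pd.2)%:R pd.1 pd.2)
      1).
Proof.
split.
  move=> u v dspF OmF PF Finfty _ law u0 _ _ cvgu.
  apply: cvg_in_probability_max => // e /andP[e0 _].
  (* The sequence at p = 1 depends on d alone, so its convergence holds along the joint filter;
     equality of the laws then carries it to every p > 0. *)
  have h1 : P 1%N pd.2 [set w | e < `|sqnorm (Z 1%N pd.2 w) / u pd.2 - 1|]
      @[pd --> filter_prod (\oo : set_system nat) \oo] --> 0%E.
    apply: (@cvg_comp _ _ _ (snd : nat * nat -> nat)
      (fun d => P 1%N d [set w | e < `|sqnorm (Z 1%N d w) / u d - 1|]) _ \oo).
      exact: cvg_snd.
    exact: (cvgu 1%N isT e e0).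
  apply: cvg_trans h1; apply: near_eq_cvg.
  exists ([set p | (0 < p)%N], [set d | (0 < d)%N]) => /=.
    by split; exact: nbhs_infty_gt.
  move=> [p d] [/= p0 d0].
  (* The event is written through the norm, whose law is what [law] compares. *)
  have mA : measurable [set r : R | e < `|r ^+ 2 / u d - 1|].
    rewrite -[X in measurable X]setTI; apply: measurable_fun_ltr => //.
    apply: measurable_norm; apply: measurable_funB => //;
      apply: measurable_funM => //.
  have := law 1%N p d isT p0 d0 _ mA; rewrite /=.
  have E q : [set w | e < `|enorm (Z q d w) ^+ 2 / u d - 1|] =
      [set w | e < `|sqnorm (Z q d w) / u d - 1|].
    by apply/funext => w /=; rewrite sqr_enorm.
  by rewrite !E.
move=> Zn; apply: (@cvg_in_probability_max _ _ _ _ _ _ (fun d => d%:R)) => //.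
  by move=> d d0; rewrite ltr0n.
move=> e e01; have /andP[e0 e1] := e01.
(* The bound on the deviation of |Z|^2 / d does not involve p, so convergence in d alone is
   enough. *)
have h1 : (gaussian_rate e ^+ pd.2 + gaussian_rate (- e) ^+ pd.2)%:E
    @[pd --> filter_prod (\oo : set_system nat) \oo] --> 0%E.
  apply: cvg_EFin; first exact: nearW.
  apply: (@cvg_comp _ _ _ (snd : nat * nat -> nat)
    (fun d => gaussian_rate e ^+ d + gaussian_rate (- e) ^+ d) _ \oo).
    exact: cvg_snd.
  have : gaussian_rate e ^+ d + gaussian_rate (- e) ^+ d @[d --> \oo] --> (0 +
    0 : R).
    by apply: cvgD; apply: cvg_expr; apply: gaussian_rate_lt1; lra.
  by rewrite addr0.
apply: (@squeeze_cvge _ _ _ _ (cst 0%E) _ _ _ 0%E _ h1); last exact: cvg_cst.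
exists ([set p | (0 < p)%N], [set d | (0 < d)%N]) => /=.
  by split; exact: nbhs_infty_gt.
move=> [p d] [/= p0 d0]; rewrite measure_ge0/=.
by apply: standard_normal_concentration => //; exact: Zn.
Qed.
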